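(* Let $\chi_0:\mathbb{R}^d\to\mathbb{C}^d$ be a measurable function, let $T\in(0,\infty]$, and let $\mathbf{X}$ be the stochastic process given by the (non-thinned) recursion with initial data $\chi_0$ described in the context. Suppose $\mathbb{E}_\xi\big[|\mathbf{X}(\xi,t)|\mathbbm{1}_{\zeta>t}\big]<\infty$ for all $(\xi,t)\in Q$, where $Q\subset\mathbb{R}^d\times[0,T)$ is a subset with full measure (with $\xi\neq0$ for $(\xi,t)\in Q$). Then the function $\chi(\xi,t)=\mathbb{E}_\xi[\mathbf{X}(\xi,t)\mathbbm{1}_{\zeta>t}]$ is well-defined and measurable on $Q$ with the integrability property $$\int_0^t|\xi|^2e^{-|\xi|^2s}\int_{\mathbb{R}^d}|\chi(\eta,s)\odot_\xi\chi(\xi-\eta,s)|\,H(\eta|\xi)\,d\eta\,ds<\infty\qquad\forall(\xi,t)\in Q.$$ Moreover, everywhere in $Q$ it satisfies $$\chi(\xi,t)=e^{-t|\xi|^2}\chi_0(\xi)+\int_0^te^{-s|\xi|^2}|\xi|^2\int_{\mathbb{R}^d}\chi(\eta,t-s)\odot_\xi\chi(\xi-\eta,t-s)\,H(\eta|\xi)\,d\eta\,ds .$$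
   Context: Product: for $\xi\in\mathbb{R}^d\setminus\{0\}$, $e_\xi=\xi/|\xi|$, $\pi_{\xi^\perp}a=a-(e_\xi\cdot a)e_\xi$ and $a\odot_\xi b=\frac{-i}{2}\big((e_\xi\cdot b)\pi_{\xi^\perp}a+(e_\xi\cdot a)\pi_{\xi^\perp}b\big)$ for $a,b\in\mathbb{C}^d$ (with $e_\xi\cdot a=\sum_j(e_\xi)_ja_j$). Kernel: $d\ge3$, and $h:\mathbb{R}^d\setminus\{0\}\to(0,\infty)$ is a fixed standard majorizing kernel, i.e. a measurable function with $(h*h)(\xi)=|\xi|h(\xi)$ for all $\xi\ne0$. $H(\eta|\xi)=\frac{h(\eta)h(\xi-\eta)}{|\xi|h(\xi)}$, a probability density in $\eta\in\mathbb{R}^d$. Cascade: $\mathbb{T}=\{0\}\cup\bigcup_{n\ge1}\{1,2\}^n$ is the binary tree with root $0$; $|v|$ is the generation of $v$ ($|0|=0$), $v|j$ is the truncation of $v$ to generation $j$ ($v|0=0$), and $v1,v2$ are the children of $v$ (the children of the root being $1,2$). For each $\xi\ne0$, on a probability space $(\Omega,\mathcal F,\mathbb{P}_\xi)$ (expectation $\mathbb{E}_\xi$) there are families $\{W_v\}_{v\in\mathbb{T}}$, $\{T_v\}_{v\in\mathbb{T}}$ such that: (i) $W_0=\xi$; (ii) given $W_v$, $T_v$ is exponentially distributed with mean $|W_v|^{-2}$, $W_{v1}$ is independent of $T_v$ with density $H(\cdot|W_v)$, and $W_{v2}=W_v-W_{v1}$; (iii) given $W_{v1}$ and $W_{v2}$,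 the sub-families (of $W$'s and $T$'s) indexed by the subtrees rooted at $v1$ and $v2$ are independent of each other (and are cascades started at $W_{v1}$, $W_{v2}$). The explosion time is $\zeta=\zeta_\xi=\sup_{n\ge0}\min_{|v|=n}\sum_{j=0}^nT_{v|j}$. Solution process: $\mathbf{X}(\xi,t)=\mathbf{X}_0(t)$, where recursively $\mathbf{X}_v(s)=\chi_0(W_v)$ if $T_v\ge s$, and $\mathbf{X}_v(s)=\mathbf{X}_{v1}(s-T_v)\odot_{W_v}\mathbf{X}_{v2}(s-T_v)$ if $T_v<s$. On the event $[\zeta>t]$ this recursion terminates after finitely many steps, so $\mathbf{X}(\xi,t)\mathbbm{1}_{\zeta>t}$ is well defined (it is $0$ off $[\zeta>t]$). A subset of a measurable set has full measure if its complement in that set has Lebesgue measure zero.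
   Formalization: In (iii) the two sub-families are assumed to be independent cascades started at W_{v1}, W_{v2} given also T_v (so T_v is independent of the sub-cascades given W_{v1}, W_{v2}); without this the equation can fail. *)

(* Defs.v *)
From HB Require Import structures.
From mathcomp Require Import all_boot all_order all_algebra.
From mathcomp Require Import all_classical all_reals all_analysis.
From mathcomp Require Import complex.

Set Implicit Arguments.
Unset Strict Implicit.
Unset Printing Implicit Defensive.

Import Order.TTheory GRing.Theory Num.Theory.
Import numFieldNormedType.Exports.

Local Open Scope classical_set_scope.
Local Open Scope ring_scope.
Local Open Scope complex_scope.

(* 'rV[T]_n carries the product sigma-algebra; for T = R this is the Borel
   sigma-algebra of R^n. *)
Definition rowvec_display : measure_display -> measure_display.
Proof. exact. Qed.

Section measurable_rowvec.
Context {dT : measure_display} {T : measurableType dT} {n : nat}.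

Let coord (i : 'I_n) (x : 'rV[T]_n) : T := x ord0 i.

Let rowvec_set0 : g_sigma_preimage coord set0.
Proof. exact: sigma_algebra0. Qed.

Let rowvec_setC A : g_sigma_preimage coord A -> g_sigma_preimage coord (~` A).
Proof. exact: sigma_algebraC. Qed.

Let rowvec_bigcup (F : _^nat) : (forall i, g_sigma_preimage coord (F i)) ->
  g_sigma_preimage coord (\bigcup_i (F i)).
Proof. exact: sigma_algebra_bigcup. Qed.

HB.instance Definition _ := @isMeasurable.Build (rowvec_display dT)
  'rV[T]_n (g_sigma_preimage coord) rowvec_set0 rowvec_setC rowvec_bigcup.

Lemma measurable_coord (i : 'I_n) :
  measurable_fun [set: 'rV[T]_n] (fun x => x ord0 i).
Proof.
move=> _ Y mY; rewrite setTI; apply: sub_sigma_algebra => /=.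
rewrite -bigcup_seq/=; exists i => /=; first by rewrite mem_index_enum.
by exists Y => //; rewrite setTI.
Qed.

Lemma measurable_fun_rowvec {d1} {T1 : measurableType d1} (f : T1 -> 'rV[T]_n) :
  (forall i, measurable_fun setT (fun x => f x ord0 i)) -> measurable_fun setT f.
Proof.
move=> mf _ A mA; move: A mA.
have : measurable `<=` [set A : set 'rV[T]_n | measurable (setT `&` f @^-1` A)].
  apply: smallest_sub; last first.
    move=> A; rewrite -bigcup_seq => -[i _ [B mB <-]] /=.
    by rewrite !setTI; have := mf i measurableT B mB; rewrite setTI.
  split => /=.
  - by rewrite preimage_set0 setI0.
  - move=> A; rewrite setTI => mA.
    by rewrite setTD preimage_setC setTI; exact: measurableC.
  - move=> F mF; rewrite preimage_bigcup setTI; apply: bigcupT_measurable => k.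
    by have := mF k; rewrite setTI.
by move=> H A mA; exact: H.
Qed.

End measurable_rowvec.

Section lebesgue_rowvec.
Context {R : realType}.

Definition rowvec_cons n (p : R * 'rV[R]_n) : 'rV[R]_n.+1 :=
  row_mx (const_mx p.1 : 'rV[R]_1) p.2.

Lemma measurable_rowvec_cons n : measurable_fun setT (@rowvec_cons n).
Proof.
apply: measurable_fun_rowvec => i.
case: (split_ordP (i : 'I_(1 + n))) => j ->.
  rewrite [X in measurable_fun _ X](_ : _ = fst)//; apply/funext => p.
  by transitivity ((const_mx p.1 : 'rV[R]_1) ord0 j);
    [exact: row_mxEl|rewrite mxE].
rewrite [X in measurable_fun _ X]
  (_ : _ = (fun x : 'rV[R]_n => x ord0 j) \o snd); last first.
  by apply/funext => p; exact: row_mxEr.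
by apply: measurableT_comp => //; exact: measurable_coord.
Qed.

Definition rowvec_uncons n (x : 'rV[R]_n.+1) : R * 'rV[R]_n :=
  (x ord0 ord0, rsubmx (x : 'rV[R]_(1 + n))).

Lemma rowvec_consK n : cancel (@rowvec_cons n) (@rowvec_uncons n).
Proof.
case=> a v; congr pair; last exact: row_mxKr.
have ord0E : ord0 = lshift n ord0 :> 'I_(1 + n) by exact: val_inj.
transitivity ((const_mx a : 'rV[R]_1) ord0 ord0); last by rewrite mxE.
exact: etrans (congr1 (rowvec_cons (a, v) ord0) ord0E) (row_mxEl _ _ _ _).
Qed.

Lemma measurable_rowvec_uncons n : measurable_fun setT (@rowvec_uncons n).
Proof.
apply: measurable_fun_pair; first exact: measurable_coord.
apply: measurable_fun_rowvec => i.
rewrite [X in measurable_fun _ X]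
  (_ : _ = (fun x : 'rV[R]_n.+1 => x ord0 (rshift 1 i))).
  exact: measurable_coord.
by apply/funext => x; rewrite mxE.
Qed.

Section step.
Variables (n : nat) (nu : {sigma_finite_measure set 'rV[R]_n -> \bar R}).

Definition lebesgue_cons : set 'rV[R]_n.+1 -> \bar R :=
  pushforward ((@lebesgue_measure R) \x nu)%E (@rowvec_cons n).

Let mcons := @measurable_rowvec_cons n.

Let lebesgue_cons0 : lebesgue_cons set0 = 0%E.
Proof. by rewrite /lebesgue_cons /pushforward preimage_set0 measure0. Qed.

Let lebesgue_cons_ge0 A : (0 <= lebesgue_cons A)%E.
Proof. exact: measure_ge0. Qed.

Let lebesgue_cons_sigma_additive : semi_sigma_additive lebesgue_cons.
Proof.
exact: (@measure_semi_sigma_additive _ _ _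
  (pushforward ((@lebesgue_measure R) \x nu)%E (@rowvec_cons n))).
Qed.

HB.instance Definition _ := isMeasure.Build _ _ _ lebesgue_cons
  lebesgue_cons0 lebesgue_cons_ge0 lebesgue_cons_sigma_additive.

Let lebesgue_cons_sigma_finite : sigma_finite setT lebesgue_cons.
Proof.
have /sigma_finiteP[F [FT Fnd Foo]] := sigma_finiteT (@lebesgue_measure R).
have /sigma_finiteP[G [GT Gnd Goo]] := sigma_finiteT nu.
exists (fun k => @rowvec_uncons n @^-1` (F k `*` G k)).
  rewrite -preimage_bigcup (_ : \bigcup_k _ = setT) ?preimage_setT//.
  apply/seteqP; split => // -[x y] _.
  have [i _ Fx] : (\bigcup_k F k) x by rewrite -FT.
  have [j _ Gy] : (\bigcup_k G k) y by rewrite -GT.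
  exists (maxn i j) => //; split => /=.
    by move: x Fx; exact/subsetPset/Fnd/leq_maxl.
  by move: y Gy; exact/subsetPset/Gnd/leq_maxr.
move=> k; have [mF Fk] := Foo k; have [mG Gk] := Goo k.
have mFG : measurable (F k `*` G k) by exact: measurableX.
split; first by rewrite -[X in measurable X]setTI; exact: measurable_rowvec_uncons.
rewrite /lebesgue_cons /pushforward -comp_preimage.
rewrite (_ : _ \o _ = id); last by apply/funext => p; exact: rowvec_consK.
by rewrite preimage_id product_measure1E// lte_mul_pinfty// ge0_fin_numE.
Qed.

HB.instance Definition _ := Measure_isSigmaFinite.Build _ _ _ lebesgue_cons
  lebesgue_cons_sigma_finite.

End step.

(* d-dimensional Lebesgue measure, as the d-fold product of the
   one-dimensional one. *)
Fixpoint lebesgue_rV (d : nat) : {sigma_finite_measure set 'rV[R]_d -> \bar R} :=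
  if d is n.+1 then lebesgue_cons (lebesgue_rV n) else dirac (0 : 'rV[R]_0).

End lebesgue_rowvec.

Section vectors.
Context {R : realType} {d : nat}.
Implicit Types (x xi : 'rV[R]_d) (a b : 'rV[R[i]]_d).

(* Euclidean norms; the canonical norm on matrices is the sup norm. *)
Definition enorm x : R := Num.sqrt (\sum_j x ord0 j ^+ 2).

Definition cnorm a : R :=
  Num.sqrt (\sum_j (complex.Re (a ord0 j) ^+ 2 + complex.Im (a ord0 j) ^+ 2)).

Definition dir xi : 'rV[R]_d := (enorm xi)^-1 *: xi.

(* Bilinear: there is no conjugation. *)
Definition dirdot xi a : R[i] := \sum_j (dir xi ord0 j)%:C * a ord0 j.

Definition perp_proj xi a : 'rV[R[i]]_d :=
  a - dirdot xi a *: map_mx (real_complex R) (dir xi).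

Definition odot xi a b : 'rV[R[i]]_d :=
  (- (0 +i* 1) / 2%:R) *: (dirdot xi b *: perp_proj xi a + dirdot xi a *: perp_proj xi b).

End vectors.

(* Measurability of f on an arbitrary, possibly non-measurable, set D, with
   respect to the trace on D of the sigma-algebra of the domain;
   measurable_fun D f is vacuous when D is not measurable. *)
Definition measurable_on d1 d2 (T1 : measurableType d1) (T2 : measurableType d2)
    (D : set T1) (f : T1 -> T2) :=
  forall Y : set T2, measurable Y -> strace measurable D (f @^-1` Y `&` D).

Section complex_vector_functions.
Context {R : realType} {d : nat} {dT : measure_display} {T : measurableType dT}.
Implicit Types (D : set T) (f : T -> 'rV[R[i]]_d).

Definition cvmeasurable_on D f := forall j : 'I_d,
  measurable_on D (fun x => complex.Re (f x ord0 j)) /\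
  measurable_on D (fun x => complex.Im (f x ord0 j)).

Definition cvintegrable (mu : {measure set T -> \bar R}) D f := forall j : 'I_d,
  mu.-integrable D (fun x => (complex.Re (f x ord0 j))%:E) /\
  mu.-integrable D (fun x => (complex.Im (f x ord0 j))%:E).

Definition cvintegral (mu : {measure set T -> \bar R}) D f : 'rV[R[i]]_d :=
  \row_j (\int[mu]_(x in D) complex.Re (f x ord0 j) +i*
          \int[mu]_(x in D) complex.Im (f x ord0 j)).

End complex_vector_functions.

Section kernel.
Context {R : realType} {d : nat}.
Local Notation E := 'rV[R]_d.
Variable h : E -> R.

(* The value h 0 is irrelevant. *)
Record standard_majorizing_kernel : Prop := StandardMajorizingKernel {
  kernel_gt0 : forall xi, xi != 0 -> 0 < h xi;
  kernel_measurable : measurable_fun [set xi : E | xi != 0] h;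
  kernel_convolution : forall xi, xi != 0 ->
    (\int[lebesgue_rV d]_eta (h eta * h (xi - eta))%:E = (enorm xi * h xi)%:E)%E
}.

Definition branching_density (eta xi : E) : R :=
  h eta * h (xi - eta) / (enorm xi * h xi).

End kernel.

(* A vertex of the binary tree is the word leading to it from the root [::],
   the letters false and true standing for 1 and 2; truncation to generation j
   is take j. *)
Notation vertex := (seq bool).

Definition child1 (v : vertex) : vertex := rcons v false.
Definition child2 (v : vertex) : vertex := rcons v true.

Section cascade.
Context {R : realType} {d : nat}.
Local Notation E := 'rV[R]_d.

(* The product sigma-algebra on the space of realizations of a whole family
   (W_v, T_v)_v. *)
Definition family_measurable : set (set (vertex -> E * R)) :=
  <<s [set C | exists u B, measurable B /\ C = [set p | B (p u)]] >>.

Variable h : E -> R.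
Context {dO : measure_display} {Omega : measurableType dO}.
Variables (P : E -> probability Omega R).
Variables (W : E -> vertex -> Omega -> E) (tau : E -> vertex -> Omega -> R).

Definition subfamily xi v omega : vertex -> E * R :=
  fun u => (W xi (v ++ u) omega, tau xi (v ++ u) omega).

Definition cascade_law xi (C : set (vertex -> E * R)) : \bar R :=
  P xi [set omega | C (subfamily xi [::] omega)].

(* For each xi != 0, (W xi, tau xi) is under P xi a cascade started at xi.
   The conditional laws are stated in integrated form. cascade_split gives the
   conditional law of (T_v, W_v1) given W_v: exponential with rate |W_v|^2,
   i.e. mean |W_v|^-2, times the density H(.|W_v). cascade_branch says that,
   given the split (W_v, T_v, W_v1), hence also W_v2, the families indexed by
   the two subtrees are independent cascades started at W_v1 and W_v2. *)
Record is_cascade : Prop := IsCascade {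
  cascade_measurableW : forall xi v, xi != 0 -> measurable_fun setT (W xi v);
  cascade_measurableT : forall xi v, xi != 0 -> measurable_fun setT (tau xi v);
  cascade_root : forall xi, xi != 0 ->
    {ae P xi, forall omega, W xi [::] omega = xi};
  cascade_child2 : forall xi v, xi != 0 ->
    {ae P xi, forall omega,
      W xi (child2 v) omega = W xi v omega - W xi (child1 v) omega};
  cascade_split : forall xi v (A : set E) (B : set R) (C : set E), xi != 0 ->
    measurable A -> measurable B -> measurable C ->
    (P xi (W xi v @^-1` A `&` tau xi v @^-1` B `&` W xi (child1 v) @^-1` C) =
     \int[P xi]_(omega in W xi v @^-1` A)
       (exponential_prob (enorm (W xi v omega) ^+ 2) B *
        \int[lebesgue_rV d]_(eta in C)
          (branching_density h eta (W xi v omega))%:E))%E;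
  cascade_branch : forall xi v (U : set (E * R * E)) C1 C2, xi != 0 ->
    measurable U -> family_measurable C1 -> family_measurable C2 ->
    let split_in_U := [set omega |
      U (W xi v omega, tau xi v omega, W xi (child1 v) omega)] in
    (P xi (split_in_U `&` subfamily xi (child1 v) @^-1` C1
                      `&` subfamily xi (child2 v) @^-1` C2) =
     \int[P xi]_(omega in split_in_U)
       (cascade_law (W xi (child1 v) omega) C1 *
        cascade_law (W xi (child2 v) omega) C2))%E
}.

Definition explosion_time xi omega : \bar R :=
  ereal_sup [set \big[Order.min/+oo%E]_(v : n.-tuple bool)
                   (\sum_(j < n.+1) tau xi (take j v) omega)%:E
            | n in [set: nat]].

Variable chi0 : E -> 'rV[R[i]]_d.

(* X_eval xi omega v s x: the recursion for X_v(s) terminates, with value x. *)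
Inductive X_eval xi omega : vertex -> R -> 'rV[R[i]]_d -> Prop :=
| X_stop v s : s <= tau xi v omega ->
    X_eval xi omega v s (chi0 (W xi v omega))
| X_branch v s x1 x2 : tau xi v omega < s ->
    X_eval xi omega (child1 v) (s - tau xi v omega) x1 ->
    X_eval xi omega (child2 v) (s - tau xi v omega) x2 ->
    X_eval xi omega v s (odot (W xi v omega) x1 x2).

Lemma X_eval_unique xi omega v s x y :
  X_eval xi omega v s x -> X_eval xi omega v s y -> x = y.
Proof.
move=> Hx; elim: Hx y => {v s x} [v s sT|v s x1 x2 Ts _ IH1 _ IH2] y Hy.
  by inversion Hy; subst => //; move: (lt_le_trans H sT); rewrite ltxx.
inversion Hy; subst; first by move: (lt_le_trans Ts H); rewrite ltxx.
by rewrite (IH1 _ H0) (IH2 _ H1).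
Qed.

Lemma X_eval_exists xi omega t : (t%:E < explosion_time xi omega)%E ->
  exists x, X_eval xi omega [::] t x.
Proof.
move=> /ereal_sup_gt[_ [n _ <-] ltt].
suff H m v s : (forall w : m.-tuple bool,
    s <= \sum_(j < m.+1) tau xi (v ++ take j w) omega) ->
    exists x, X_eval xi omega v s x.
  apply: (H n) => w; rewrite -lee_fin; apply/ltW/(lt_le_trans ltt).
  exact: bigmin_le_cond.
elim: m v s => [|m IH] v s Hs.
  have := Hs [tuple]; rewrite big_ord1 cats0 => sT.
  by exists (chi0 (W xi v omega)); exact: X_stop.
have [sT|Ts] := leP s (tau xi v omega).
  by exists (chi0 (W xi v omega)); exact: X_stop.
have step b : exists x, X_eval xi omega (rcons v b) (s - tau xi v omega) x.
  apply: IH => w; have := Hs [tuple of b :: w].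
  rewrite big_ord_recl take0 cats0 -lerBlDl => /le_trans; apply.
  by rewrite le_eqVlt; apply/orP; left; apply/eqP/eq_bigr => j _; rewrite cat_rcons.
have [x1 Hx1] := step false; have [x2 Hx2] := step true.
by exists (odot (W xi v omega) x1 x2); exact: X_branch.
Qed.

(* X(xi, t) 1_{zeta > t}; by the two lemmas above, xget picks the unique value
   of the recursion. *)
Definition solution_process xi (t : R) omega : 'rV[R[i]]_d :=
  if (t%:E < explosion_time xi omega)%E
  then xget 0 [set x | X_eval xi omega [::] t x] else 0.

Definition solution_mean xi (t : R) : 'rV[R[i]]_d :=
  cvintegral (P xi) setT (solution_process xi t).

End cascade.

(* Main.v *)
Require Import Defs.
From HB Require Import structures.
From mathcomp Require Import all_boot all_order all_algebra.
From mathcomp Require Import all_classical all_reals all_analysis.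
From mathcomp Require Import complex.
From mathcomp Require Import measurable_realfun giry ring lra.

(** Write zeta for the explosion time and X for the solution process. The
    equation is the first-step decomposition of E_xi[X(xi, t) 1_{zeta > t}] at
    the root of the tree.

    The root waits an exponential time T_0 of rate |xi|^2. If T_0 >= t, then
    X = chi0(xi), and no explosion has occurred since all waiting times are
    almost surely positive ([ae_time_gt0]); this gives the term
    exp(-t |xi|^2) chi0(xi). If T_0 = s < t, then zeta > t if and only if both
    subtrees survive past t - s, in which case X is the product of the two
    processes of the subtrees at time t - s; with the convention that a process
    is 0 after explosion, the product formula is valid in all cases
    ([canonical_process_branch]). Given the splitting, the subtrees are
    independent cascades started at eta and xi - eta, and the product is bilinear,
    so the conditional expectation of X is the product of chi(eta, t - s) and
    chi(xi - eta, t - s) ([integral_odot], [good_branch]). This needs both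
    expectations to exist, which holds for almost every (s, eta) because Q has
    full measure ([ae_good]). Integrating against the density
    |xi|^2 exp(-s |xi|^2) H(eta | xi) of the splitting gives the equation
    ([solution_mean_split], [integral_mean_odot]). The same computation with norms
    bounds the integral of |chi odot chi| by a multiple of
    E_xi[|X(xi, t)| 1_{zeta > t}] ([integral_cnorm_mean_odot]), up to a time
    reversal on [0, t] ([integral_cnorm_odot_lty]).

    To integrate over eta, the law of the cascade must depend measurably on its
    starting point. It does, because it is determined by the splitting density and
    the branching property: an induction on the depth of boxes, i.e. of events
    bearing on finitely many generations, followed by Dynkin's lemma, turns the
    laws into a probability kernel ([measurable_family_law_set]). The solution
    process is a jointly measurable function of time and of the realized family
    ([measurable_canonical_process]), so chi is jointly measurable off xi = 0
    ([measurable_law_mean]). Disintegration along the first splitting then holds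
    for all nonnegative measurable integrands ([ge0_integral_first_step]). *)

Set Implicit Arguments.
Unset Strict Implicit.
Unset Printing Implicit Defensive.

Import Order.TTheory GRing.Theory Num.Theory.
Import numFieldNormedType.Exports.

Local Open Scope classical_set_scope.
Local Open Scope ring_scope.
Local Open Scope complex_scope.

(** * Integration *)

Section integral_toolbox.
Local Open Scope ereal_scope.
Import HBNNSimple.

Section negligible_change.
Context d (T : measurableType d) (R : realType).
Variable mu : {measure set T -> \bar R}.

Let ge0_le_integral_off_null (N : set T) (f g : T -> \bar R) :
  measurable N -> mu N = 0 -> (forall x, 0 <= f x) -> (forall x, 0 <= g x) ->
  (forall x, ~ N x -> f x = g x) -> \int[mu]_x f x <= \int[mu]_x g x.
Proof.
move=> mN N0 f0 g0 fg; rewrite (ge0_integralTE mu f0) (ge0_integralTE mu g0).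
apply/ereal_supP => _ [u /= uf <-].
have mCN : measurable (~` N) by exact: measurableC.
pose v : {nnsfun T >-> R} := mul_nnsfun u (indic_nnsfun R mCN).
apply: le_ereal_sup_tmp; exists (sintegral mu u) => //; exists v => /=.
  move=> x; rewrite /v /= /mindic indicE; have [Nx|Nx] := pselect (N x).
    by rewrite memNset ?mulr0//= => /(_ Nx).
  by rewrite mem_set// mulr1 -fg// uf.
rewrite -!integralT_nnsfun; apply: ae_eq_integral => //.
- exact/measurable_EFinP.
- exact/measurable_EFinP.
- exists N; split => // x /= /not_implyP[_]; apply: contra_notP => Nx.
  by rewrite /v /= /mindic indicE mem_set//= mulr1.
Qed.

(** The integral of a nonnegative function, measurable or not, is a supremum over
    the simple functions below it, and a simple function may be set to 0 on a null
    set without changing its integral. *)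
Lemma integral_eq_off_null (N : set T) (f g : T -> \bar R) :
  measurable N -> mu N = 0 -> (forall x, ~ N x -> f x = g x) ->
  \int[mu]_x f x = \int[mu]_x g x.
Proof.
move=> mN N0 fg; rewrite integralE [RHS]integralE.
by congr (_ - _); apply/eqP; rewrite eq_le; apply/andP; split;
  apply: (ge0_le_integral_off_null mN N0) => // x /fg; rewrite ?funeposE ?funenegE => ->.
Qed.

Lemma ae_eq_integralT (f g : T -> \bar R) :
  {ae mu, forall x, f x = g x} -> \int[mu]_x f x = \int[mu]_x g x.
Proof.
move=> [N [mN N0 sN]]; apply: (integral_eq_off_null mN N0) => x Nx.
by apply: contrapT => fgx; apply/Nx/sN.
Qed.

Lemma ae_eq_integral_in (D : set T) (f g : T -> \bar R) :
  {ae mu, forall x, D x -> f x = g x} ->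
  \int[mu]_(x in D) f x = \int[mu]_(x in D) g x.
Proof.
move=> fg; rewrite integral_mkcond [RHS]integral_mkcond.
apply: ae_eq_integralT; apply: filterS fg => x fg; rewrite !patchE.
by case: ifPn => // /set_mem.
Qed.

End negligible_change.

Lemma integral_pushforwardT d1 d2 (T1 : measurableType d1)
    (T2 : measurableType d2) (R : realType) (mu : {measure set T1 -> \bar R})
    (nu : {measure set T2 -> \bar R}) (phi : T1 -> T2) (f : T2 -> \bar R) :
  measurable_fun setT phi -> measurable_fun setT f ->
  (forall A, measurable A -> nu A = mu (phi @^-1` A)) ->
  \int[nu]_y f y = \int[mu]_x f (phi x).
Proof.
move=> mphi mf nuE.
have ge0 (g : T2 -> \bar R) : measurable_fun setT g -> (forall y, 0 <= g y) ->
    \int[nu]_y g y = \int[mu]_x g (phi x).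
  move=> mg g0; transitivity (\int[pushforward mu phi]_y g y).
    by apply: eq_measure_integral => A mA _; exact: nuE.
  by rewrite ge0_integral_pushforward.
rewrite integralE [RHS]integralE; congr (_ - _).
  rewrite (ge0 f^\+)//; last exact: measurable_funepos.
  by apply: eq_integral => x _; rewrite !funeposE.
rewrite (ge0 f^\-)//; last exact: measurable_funeneg.
by apply: eq_integral => x _; rewrite !funenegE.
Qed.

(** Rectangles form a generating pi-system. *)
Lemma finite_measure_eq_rect d1 d2 (T1 : measurableType d1)
    (T2 : measurableType d2) (R : realType)
    (m1 m2 : {measure set (T1 * T2) -> \bar R}) :
  m1 setT < +oo ->
  (forall A B, measurable A -> measurable B -> m1 (A `*` B) = m2 (A `*` B)) ->
  forall S, measurable S -> m1 S = m2 S.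
Proof.
move=> fin mE S mS.
apply: (measure_unique [set A `*` B | A in measurable & B in measurable]
  (fun _ => setT)) => //.
- exact: measurable_prod_measurableType.
- move=> _ _ [A mA [B mB <-]] [A' mA' [B' mB' <-]]; exists (A `&` A').
    exact: measurableI.
  by exists (B `&` B'); [exact: measurableI|rewrite setXI].
- by move=> _; exists setT => //; exists setT => //; rewrite setXTT.
- by rewrite bigcup_const.
- by move=> _ [A mA [B mB <-]]; exact: mE.
Qed.

(** Fixing one side of the rectangles turns each measure into a measure on the
    remaining product, so that the two-factor case applies twice. *)
Lemma finite_measure_eq_rect3 d1 d2 d3 (T1 : measurableType d1)
    (T2 : measurableType d2) (T3 : measurableType d3) (R : realType)
    (m1 m2 : {measure set (T1 * (T2 * T3)) -> \bar R}) :
  m1 setT < +oo ->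
  (forall A B C, measurable A -> measurable B -> measurable C ->
    m1 (A `*` (B `*` C)) = m2 (A `*` (B `*` C))) ->
  forall S, measurable S -> m1 S = m2 S.
Proof.
move=> fin mE; apply: finite_measure_eq_rect => // A D mA mD.
have mAT : measurable (A `*` [set: T2 * T3]) by exact: measurableX.
have slice (m : {measure set (T1 * (T2 * T3)) -> \bar R}) :
    {m' : {measure set (T2 * T3) -> \bar R} | forall B, m' B = m (A `*` B)}.
  unshelve eexists (pushforward (mrestr m mAT) snd).
    exact: (@measurable_snd _ _ T1 (T2 * T3)%type).
  move=> B; rewrite /= /pushforward /mrestr/=; congr (m _).
  by apply/seteqP; split => p /=; tauto.
have [[m1' m1E] [m2' m2E]] := (slice m1, slice m2).
rewrite -m1E -m2E; apply: finite_measure_eq_rect => //.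
  by rewrite m1E; apply: le_lt_trans fin; apply: le_measure; rewrite ?inE//;
    apply: measurableX.
by move=> B C mB mC; rewrite m1E m2E; exact: mE.
Qed.

Section density_measure.
Context d (T : measurableType d) (R : realType).
Variables (mu : {measure set T -> \bar R}) (g : T -> R).
Hypotheses (mg : measurable_fun setT g) (g0 : forall x, (0 <= g x)%R).

(** The proofs are arguments so that the structure of measure can be attached to
    the definition. *)
Definition density_measure (mg : measurable_fun setT g) (g0 : forall x, (0 <= g x)%R)
  (A : set T) := \int[mu]_(x in A) (g x)%:E.

Local Notation nu := (density_measure mg g0).

Let nu0 : nu set0 = 0. Proof. exact: integral_set0. Qed.

Let nu_ge0 A : 0 <= nu A.
Proof. by apply: integral_ge0 => x _; rewrite lee_fin. Qed.

Let nu_sigma_additive : semi_sigma_additive nu.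
Proof.
move=> F mF tF mUF; rewrite /density_measure; apply: cvg_toP.
  apply: ereal_nondecreasing_is_cvgn => m n mn.
  by apply: lee_sum_nneg_natr => // k _ _; exact: nu_ge0.
rewrite ge0_integral_bigcup//.
- by apply/measurable_funTS/measurableT_comp.
- by move=> x _; rewrite lee_fin.
Qed.

HB.instance Definition _ := isMeasure.Build _ _ _ nu nu0 nu_ge0 nu_sigma_additive.

Definition mdensity : {measure set T -> \bar R} := nu.

Let integral_nnsfun_mdensity (u : {nnsfun T >-> R}) :
  \int[mdensity]_x (u x)%:E = \int[mu]_x ((u x)%:E * (g x)%:E).
Proof.
rewrite integralT_nnsfun sintegralE.
transitivity (\sum_(r \in range u)
    \int[mu]_x (r%:E * ((\1_(u @^-1` [set r]) x)%:E * (g x)%:E))).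
  apply: eq_fsbigr => r /set_mem[x _ ur].
  have r0 : (0 <= r)%R by rewrite -ur.
  rewrite ge0_integralZl//; first last.
  - by move=> y _; rewrite mule_ge0// lee_fin.
  - by apply: emeasurable_funM => //; exact/measurable_EFinP.
  congr (_ * _); rewrite /mdensity /= /density_measure integral_mkcond.
  apply: eq_integral => y _; rewrite patchE indicE.
  by case: ifPn => _; rewrite ?mul1e ?mul0e.
rewrite -ge0_integral_fsum//.
- apply: eq_integral => x _; rewrite [in RHS]fimfunE -fsumEFin//.
  rewrite ge0_mule_fsuml; last by move=> r; exact: nnfun_muleindic_ge0.
  by apply: eq_fsbigr => r _; rewrite muleA EFinM.
- move=> r; apply: measurable_funeM; apply: emeasurable_funM => //; last exact/measurable_EFinP.
  exact/measurable_EFinP.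
- move=> r x _; rewrite muleA mule_ge0// ?lee_fin//.
  exact: nnfun_muleindic_ge0.
Qed.

Lemma ge0_integral_mdensity (f : T -> \bar R) : measurable_fun setT f ->
  (forall x, 0 <= f x) -> \int[mdensity]_x f x = \int[mu]_x (f x * (g x)%:E).
Proof.
move=> mf f0; pose f_ := nnsfun_approx measurableT mf.
have f_f x : (f_ n x)%:E @[n --> \oo] --> f x by exact: cvg_nnsfun_approx.
have ndf x : {homo (fun n => (f_ n x)%:E) : n m / (n <= m)%O >-> n <= m}.
  by move=> n m nm; rewrite lee_fin; exact/lefP/nd_nnsfun_approx.
transitivity (limn (fun n => \int[mdensity]_x (f_ n x)%:E)).
  rewrite -monotone_convergence//.
  - by apply: eq_integral => x _; apply/esym/cvg_lim => //; exact: f_f.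
  - by move=> n; exact/measurable_EFinP.
  - by move=> n x _; rewrite lee_fin.
under eq_fun do rewrite integral_nnsfun_mdensity.
rewrite -monotone_convergence//.
- apply: eq_integral => x _; apply/cvg_lim => //.
  by apply: cvgeZr => //; exact: f_f.
- by move=> n; apply: emeasurable_funM => //; exact/measurable_EFinP.
- by move=> n x _; rewrite mule_ge0// lee_fin.
- by move=> x _ n m nm; apply: lee_wpmul2r; [rewrite lee_fin|exact: ndf].
Qed.

End density_measure.
End integral_toolbox.

(** * Row vectors and Lebesgue measure *)

Section rowvec_measurability.
Context {R : realType} {d : nat}.
Local Notation E := 'rV[R]_d.

Lemma measurable_rowvecB {dT} {T : measurableType dT} (f g : T -> E) :
  measurable_fun setT f -> measurable_fun setT g ->
  measurable_fun setT (fun x => f x - g x).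
Proof.
move=> mf mg; apply: measurable_fun_rowvec => i.
rewrite (_ : (fun _ => _) = (fun x => f x ord0 i - g x ord0 i)); last first.
  by apply/funext => x; rewrite !mxE.
by apply: measurable_funB; [exact: (measurableT_comp (measurable_coord i) mf)
                           |exact: (measurableT_comp (measurable_coord i) mg)].
Qed.

Lemma measurable_rowvec1 (v : E) : measurable [set v].
Proof.
pose f (x : E) : R := \sum_i `|x ord0 i - v ord0 i|.
have mf : measurable_fun setT f.
  apply: measurable_sum => i; apply: measurableT_comp => //.
  by apply: measurable_funB => //; exact: measurable_coord.
rewrite (_ : [set v] = f @^-1` [set 0]).
  by rewrite -[X in measurable X]setTI; exact: mf.
apply/seteqP; split => [_ -> /=|x /= fx0].
  by rewrite /f big1// => i _; rewrite subrr normr0.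
apply/rowP => i; apply/eqP; rewrite -subr_eq0 -normr_eq0; apply/eqP.
exact: (psumr_eq0P _ fx0).
Qed.

Lemma measurable_rowvec_eq {dT} {T : measurableType dT} (f : T -> E) (v : E) :
  measurable_fun setT f -> measurable_fun setT (fun x => f x == v).
Proof.
move=> mf; apply: (measurable_fun_bool true); rewrite setTI.
rewrite (_ : _ @^-1` _ = f @^-1` [set v]).
  by rewrite -[X in measurable X]setTI; apply: mf => //; exact: measurable_rowvec1.
by apply/seteqP; split => x /eqP.
Qed.

Lemma measurable_Vr {dT} {T : measurableType dT} (f : T -> R) :
  (forall x, 0 <= f x) ->
  measurable_fun setT f -> measurable_fun setT (fun x => (f x)^-1).
Proof.
move=> f0 mf; rewrite (_ : (fun _ => _) = (fun x => f x `^ (-1))); last first.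
  by apply/funext => x; rewrite powR_inv1.
exact: (measurableT_comp (measurable_powR _)).
Qed.

Lemma measurable_sqrtr {dT} {T : measurableType dT} (f : T -> R) :
  (forall x, 0 <= f x) ->
  measurable_fun setT f -> measurable_fun setT (fun x => Num.sqrt (f x)).
Proof.
move=> f0 mf; rewrite (_ : (fun _ => _) = (fun x => f x `^ (2^-1))); last first.
  by apply/funext => x; rewrite powR12_sqrt.
exact: (measurableT_comp (measurable_powR _)).
Qed.

Lemma enorm_ge0 (x : E) : 0 <= enorm x.
Proof. exact: sqrtr_ge0. Qed.

Lemma enorm_gt0 (x : E) : x != 0 -> 0 < enorm x.
Proof.
move=> x0; rewrite sqrtr_gt0 lt_neqAle sumr_ge0 ?andbT; last first.
  by move=> i _; exact: sqr_ge0.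
apply: contra x0 => /eqP/esym s0; apply/eqP/rowP => i; rewrite mxE.
apply/eqP; rewrite -sqrf_eq0; apply/eqP.
by apply: (psumr_eq0P _ s0) => // j _; exact: sqr_ge0.
Qed.

Lemma measurable_enorm {dT} {T : measurableType dT} (f : T -> E) :
  measurable_fun setT f -> measurable_fun setT (fun x => enorm (f x)).
Proof.
move=> mf; apply: measurable_sqrtr => [x|].
  by apply: sumr_ge0 => i _; exact: sqr_ge0.
apply: measurable_sum => i; apply: measurable_funX.
exact: (measurableT_comp (measurable_coord i)).
Qed.

Lemma measurable_dir {dT} {T : measurableType dT} (f : T -> E) j :
  measurable_fun setT f -> measurable_fun setT (fun x => dir (f x) ord0 j).
Proof.
move=> mf; rewrite (_ : (fun _ => _) =
    (fun x => (enorm (f x))^-1 * f x ord0 j)); last first.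
  by apply/funext => x; rewrite mxE.
apply: measurable_funM; last exact: (measurableT_comp (measurable_coord j)).
by apply: measurable_Vr => [x|]; [exact: enorm_ge0|exact: measurable_enorm].
Qed.

End rowvec_measurability.

Section lebesgue_rowvec.
Context {R : realType}.
Local Open Scope ereal_scope.

Lemma lebesgue_reflect (c : R) (A : set R) : measurable A ->
  (@lebesgue_measure R) ((fun x => c - x)%R @^-1` A) = (@lebesgue_measure R) A.
Proof.
move=> mA; apply/esym.
have mr : measurable_fun setT (fun x : measurableTypeR R => (c - x)%R : measurableTypeR R).
  by apply: measurable_funB.
apply: (lebesgue_measure_unique
  (mu := (pushforward lebesgue_measure
     (fun x : measurableTypeR R => (c - x)%R : measurableTypeR R)))) => //.
move=> _ [[a b]] _ <-; rewrite /pushforward /=.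
rewrite [X in _ = lebesgue_measure X](_ : _ = `[(c - b)%R, (c - a)%R[%classic).
  rewrite !lebesgue_measure_itv/= !lte_fin.
  have -> : (c - b < c - a)%R = (a < b)%R by rewrite ltrD2l ltrN2.
  by case: ifPn => // _; congr (_%:E); ring.
by apply/seteqP; split => x /=; rewrite !in_itv/= => /andP[? ?]; apply/andP; split; lra.
Qed.

(** Tonelli's theorem, one coordinate at a time. *)
Lemma product_measure_preserving d1 d2 (T1 : measurableType d1)
    (T2 : measurableType d2) (m1 : {sigma_finite_measure set T1 -> \bar R})
    (m2 : {sigma_finite_measure set T2 -> \bar R}) (f1 : T1 -> T1) (f2 : T2 -> T2) :
  measurable_fun setT f1 -> measurable_fun setT f2 ->
  (forall A, measurable A -> m1 (f1 @^-1` A) = m1 A) ->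
  (forall A, measurable A -> m2 (f2 @^-1` A) = m2 A) ->
  forall B, measurable B ->
    (m1 \x m2) ((fun p => (f1 p.1, f2 p.2)) @^-1` B) = (m1 \x m2) B.
Proof.
move=> mf1 mf2 p1 p2 B mB; rewrite /= /product_measure1/=.
transitivity (\int[m1]_x (m2 \o xsection B) (f1 x)).
  apply: eq_integral => x _ /=; rewrite -[RHS]p2; last exact: measurable_xsection.
  by congr (m2 _); apply/seteqP; split => y /=; rewrite /xsection/= !inE.
rewrite -(@integral_pushforwardT _ _ _ _ _ m1 m1 f1 (m2 \o xsection B))//.
  exact: measurable_fun_xsection.
by move=> A mA; exact/esym/p1.
Qed.

Let rowvec_consl d (p : R * 'rV[R]_d) (j : 'I_1) :
  rowvec_cons p ord0 (lshift d j : 'I_(1 + d)) = p.1.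
Proof.
by transitivity ((const_mx p.1 : 'rV[R]_1) ord0 j); [exact: row_mxEl|rewrite mxE].
Qed.

Let rowvec_consr d (p : R * 'rV[R]_d) (j : 'I_d) :
  rowvec_cons p ord0 (rshift 1 j : 'I_(1 + d)) = p.2 ord0 j.
Proof. exact: row_mxEr. Qed.

Let rowvec_unconsK d (v : 'rV[R]_d.+1) : rowvec_cons (rowvec_uncons v) = v.
Proof.
apply/rowP => i; case: (split_ordP (i : 'I_(1 + d))) => j ->.
  apply: etrans (rowvec_consl _ j) _ => /=.
  by congr (v _ _); rewrite ord1; exact: val_inj.
by apply: etrans (rowvec_consr _ j) _; rewrite mxE.
Qed.

(** The two children of a particle with wave number [c] are exchanged by the
    reflection [x |-> c - x], so whatever holds for almost every first child
    also holds for almost every second child. *)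
Lemma lebesgue_rV_reflect d (c : 'rV[R]_d) (A : set 'rV[R]_d) : measurable A ->
  lebesgue_rV d ((fun x => c - x)%R @^-1` A) = lebesgue_rV d A.
Proof.
elim: d c A => [|d IH] c A mA.
  congr (lebesgue_rV 0 _); apply/seteqP.
  by split=> x /=; rewrite (thinmx0 (c - x)%R) (thinmx0 x).
have mcA : measurable (@rowvec_cons R d @^-1` A).
  by rewrite -[X in measurable X]setTI; exact: measurable_rowvec_cons.
rewrite /= /lebesgue_cons /pushforward.
rewrite (_ : _ @^-1` _ = (fun p : R * 'rV[R]_d => ((rowvec_uncons c).1 - p.1,
    (rowvec_uncons c).2 - p.2)%R) @^-1` (@rowvec_cons R d @^-1` A)).
  apply: (@product_measure_preserving _ _ _ _ lebesgue_measure (lebesgue_rV d)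
    (fun x : R => _ - x)%R (fun x : 'rV[R]_d => _ - x)%R) => //.
  - exact: measurable_funB.
  - exact: measurable_rowvecB.
  - exact: lebesgue_reflect.
  - exact: IH.
suff H p : (c - rowvec_cons p =
    rowvec_cons ((rowvec_uncons c).1 - p.1, (rowvec_uncons c).2 - p.2))%R.
  by apply/seteqP; split => p /=; rewrite H.
rewrite -[in LHS](rowvec_unconsK c); case: (rowvec_uncons c) => a w /=.
have subE (u v : 'rV[R]_(1 + d)) k : ((u - v) ord0 k = u ord0 k - v ord0 k)%R.
  by rewrite !mxE.
apply/rowP => i; rewrite (subE (rowvec_cons _)).
case: (split_ordP (i : 'I_(1 + d))) => j ->.
  by apply: etrans (esym (rowvec_consl _ j)); rewrite !rowvec_consl.
by apply: etrans (esym (rowvec_consr _ j)); rewrite !rowvec_consr/= !mxE.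
Qed.

Lemma lebesgue_rV1 d (v : 'rV[R]_d) : (0 < d)%N -> lebesgue_rV d [set v] = 0.
Proof.
case: d v => // d v _; rewrite /= /lebesgue_cons /pushforward.
rewrite (_ : _ @^-1` _ = [set (rowvec_uncons v).1] `*` [set (rowvec_uncons v).2]).
  rewrite [LHS]product_measure1E//; last exact: measurable_rowvec1.
  by apply: etrans (mul0e _); congr (_ * _); exact: lebesgue_measure_set1.
apply/seteqP; split => [p /= pv|[x y] /= [-> ->]].
  by have := rowvec_consK p; rewrite pv => <-.
exact: rowvec_unconsK.
Qed.

End lebesgue_rowvec.

(** * The bilinear product on complex vectors *)

Section complex_vectors.
Context {R : realType} {d : nat}.
Local Notation E := 'rV[R]_d.
Local Notation V := 'rV[R[i]]_d.
Implicit Types (a b : V) (xi : E).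

Lemma dirdotD xi a b : dirdot xi (a + b) = dirdot xi a + dirdot xi b.
Proof. by rewrite /dirdot -big_split/=; apply: eq_bigr => j _; rewrite [(a + b) _ _]mxE mulrDr. Qed.

Lemma dirdotZ xi (c : R[i]) a : dirdot xi (c *: a) = c * dirdot xi a.
Proof. by rewrite /dirdot mulr_sumr; apply: eq_bigr => j _; rewrite [(c *: a) _ _]mxE mulrCA. Qed.

Lemma perp_projD xi a b : perp_proj xi (a + b) = perp_proj xi a + perp_proj xi b.
Proof. by rewrite /perp_proj dirdotD scalerDl opprD addrACA. Qed.

Lemma perp_projZ xi (c : R[i]) a : perp_proj xi (c *: a) = c *: perp_proj xi a.
Proof. by rewrite /perp_proj dirdotZ scalerBr scalerA. Qed.

Lemma odotC xi a b : odot xi a b = odot xi b a.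
Proof. by rewrite /odot addrC. Qed.

Lemma odotDr xi a b b' : odot xi a (b + b') = odot xi a b + odot xi a b'.
Proof.
rewrite /odot dirdotD perp_projD -[RHS]scalerDr; congr (_ *: _).
by rewrite scalerDl (scalerDr (dirdot xi a)) addrACA.
Qed.

Lemma odotZr xi (c : R[i]) a b : odot xi a (c *: b) = c *: odot xi a b.
Proof.
rewrite /odot dirdotZ perp_projZ [RHS]scalerA [in RHS](mulrC c) -[RHS]scalerA.
by congr (_ *: _); rewrite (scalerDr c (dirdot xi b *: perp_proj xi a)) !scalerA (mulrC c (dirdot xi a)).
Qed.

Lemma odotDl xi a a' b : odot xi (a + a') b = odot xi a b + odot xi a' b.
Proof. by rewrite odotC odotDr !(odotC _ b). Qed.

Lemma odotZl xi (c : R[i]) a b : odot xi (c *: a) b = c *: odot xi a b.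
Proof. by rewrite odotC odotZr (odotC _ b). Qed.

Lemma odot0r xi a : odot xi a 0 = 0.
Proof. by have := odotZr xi 0 a 0; rewrite !scale0r. Qed.

Lemma odot0l xi a : odot xi 0 a = 0.
Proof. by rewrite odotC odot0r. Qed.

(** The 2d real coordinates of a complex vector. Every complex quantity is
    handled through them, because the integrals of vectors are defined from real
    integrals of real and imaginary parts. *)
Definition rcoord (k : 'I_d * bool) a : R :=
  if k.2 then complex.Im (a ord0 k.1) else complex.Re (a ord0 k.1).

Definition rbasis (k : 'I_d * bool) : V :=
  (if k.2 then 'i else 1) *: delta_mx ord0 k.1.

Lemma rcoord_eq a b : (forall k, rcoord k a = rcoord k b) -> a = b.
Proof.
move=> ab; apply/rowP => j; apply/eqP; rewrite eq_complex.
by have := ab (j, true); have := ab (j, false); rewrite /rcoord/= => -> ->; rewrite !eqxx.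
Qed.

(** Linearity over the reals, since real and imaginary parts are not linear over
    the complex numbers. *)
Definition real_linear (f : V -> R) :=
  (forall a b, f (a + b) = f a + f b) /\ (forall (r : R) a, f (r%:C *: a) = r * f a).

Lemma real_linear_rcoord k : real_linear (rcoord k).
Proof.
split => [a b|r a]; rewrite /rcoord !mxE; first by case: ifP => _; rewrite raddfD.
by case: (a _ _) => x y; case: ifP => _ /=; rewrite !mul0r ?subr0 ?addr0.
Qed.

Lemma sum_rcoord a : a = \sum_k (rcoord k a)%:C *: rbasis k.
Proof.
rewrite -(pair_bigA _ (fun j (s : bool) => (rcoord (j, s) a)%:C *: rbasis (j, s)))/=.
rewrite [LHS]row_sum_delta; apply: eq_bigr => j _.
rewrite big_bool/= /rbasis /rcoord/= scale1r scalerA -scalerDl addrC.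
by congr (_ *: _); case: (a _ _) => x y; simpc.
Qed.

Lemma real_linearE f a : real_linear f -> f a = \sum_k rcoord k a * f (rbasis k).
Proof.
move=> [fD fZ]; rewrite {1}(sum_rcoord a).
have f0 : f 0 = 0 by have := fZ 0 0; rewrite mul0r scaler0.
by rewrite (big_morph f fD f0); apply: eq_bigr => k _; rewrite fZ.
Qed.

Lemma real_linear_odotr k xi a : real_linear (fun b => rcoord k (odot xi a b)).
Proof.
have [kD kZ] := real_linear_rcoord k.
by split => [b b'|r b]; rewrite ?odotDr ?odotZr ?kD ?kZ.
Qed.

Lemma real_linear_odotl k xi b : real_linear (fun a => rcoord k (odot xi a b)).
Proof.
have [kD kZ] := real_linear_rcoord k.
by split => [a a'|r a]; rewrite ?odotDl ?odotZl ?kD ?kZ.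
Qed.

Lemma cnorm_ge0 a : 0 <= cnorm a.
Proof. exact: sqrtr_ge0. Qed.

Lemma cnorm0 : cnorm (0 : V) = 0.
Proof.
rewrite /cnorm big1 ?sqrtr0// => j _.
by rewrite !mxE /= expr0n addr0.
Qed.

Lemma rcoord_le_cnorm k a : `|rcoord k a| <= cnorm a.
Proof.
rewrite -sqrtr_sqr ler_sqrt; last first.
  by apply: sumr_ge0 => j _; rewrite addr_ge0// sqr_ge0.
rewrite (bigD1 k.1)//= /rcoord; set S := \sum_(_ | _) _.
have S0 : 0 <= S by apply: sumr_ge0 => j _; rewrite addr_ge0// sqr_ge0.
by case: ifP => _; rewrite -?addrA ?lerDl ?lerDr ?addr_ge0// 1?addrCA ?lerDl ?addr_ge0// ?sqr_ge0.
Qed.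

Lemma cnorm_le_sum a : cnorm a <= \sum_k `|rcoord k a|.
Proof.
have S0 : 0 <= \sum_k `|rcoord k a| by exact: sumr_ge0.
rewrite -(ler_pXn2r (ltn0Sn 1)) ?nnegrE ?cnorm_ge0// sqr_sqrtr; last first.
  by apply: sumr_ge0 => j _; rewrite addr_ge0// sqr_ge0.
apply: (@le_trans _ _ (\sum_k `|rcoord k a| ^+ 2)).
  rewrite -(pair_bigA _ (fun j (s : bool) => `|rcoord (j, s) a| ^+ 2))/=.
  by apply: ler_sum => j _; rewrite big_bool/= /rcoord/= !real_normK ?num_real// addrC.
rewrite [leRHS]expr2 mulr_suml; apply: ler_sum => k _.
by rewrite expr2 ler_wpM2l// (bigD1 k)//= lerDl sumr_ge0.
Qed.

Lemma real_linear_le f : real_linear f ->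
  forall a, `|f a| <= (\sum_k `|f (rbasis k)|) * cnorm a.
Proof.
move=> lf a; rewrite (real_linearE a lf) mulr_suml.
apply: le_trans (ler_norm_sum _ _ _) _; apply: ler_sum => k _.
by rewrite normrM mulrC ler_wpM2l// rcoord_le_cnorm.
Qed.

(** Expansion of both arguments in the real basis. The bound makes the product of
    independent integrable vectors integrable, so that Fubini's theorem applies. *)
Lemma rcoord_odot_le k xi : exists2 K : R, 0 <= K &
  forall a b, `|rcoord k (odot xi a b)| <= K * cnorm a * cnorm b.
Proof.
exists (\sum_l \sum_m `|rcoord k (odot xi (rbasis l) (rbasis m))|).
  by do 2!(apply: sumr_ge0 => ? _).
move=> a b; apply: le_trans (real_linear_le (real_linear_odotl k xi b) a) _.
rewrite mulrAC ler_wpM2r ?cnorm_ge0// mulr_suml; apply: ler_sum => l _.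
exact: (real_linear_le (real_linear_odotr k xi (rbasis l)) b).
Qed.

End complex_vectors.

(** * Measurable and integrable complex vector functions *)

Section complex_measurability.
Context {R : realType} {d : nat} {dT : measure_display} {T : measurableType dT}.
Local Notation E := 'rV[R]_d.
Local Notation V := 'rV[R[i]]_d.

Definition cvmeasurable (f : T -> V) :=
  forall k, measurable_fun setT (fun x => rcoord k (f x)).

Definition cmeasurable (f : T -> R[i]) :=
  measurable_fun setT (fun x => complex.Re (f x)) /\
  measurable_fun setT (fun x => complex.Im (f x)).

Lemma cvmeasurable_onP (f : T -> V) : cvmeasurable_on setT f -> cvmeasurable f.
Proof.
move=> mf [j b]; have [mr mi] := mf j.
have on (g : T -> R) : measurable_on setT g -> measurable_fun setT g.
  by move=> mg _ Y mY; have [A mA] := mg Y mY; rewrite !setIT setTI => <-.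
by case: b; rewrite /rcoord/=; exact: on.
Qed.

Lemma cvmeasurableE (f : T -> V) :
  cvmeasurable f <-> forall j, cmeasurable (fun x => f x ord0 j).
Proof.
split=> [mf j|mf [j b]]; first by split; [exact: (mf (j, false))|exact: (mf (j, true))].
by have [] := mf j; case: b.
Qed.

Lemma cmeasurableD f g : cmeasurable f -> cmeasurable g ->
  cmeasurable (fun x => f x + g x).
Proof.
move=> [fr fi] [gr gi]; split.
  under eq_fun do rewrite raddfD/=; exact: measurable_funD.
by under eq_fun do rewrite raddfD/=; exact: measurable_funD.
Qed.

Lemma cmeasurableM f g : cmeasurable f -> cmeasurable g ->
  cmeasurable (fun x => f x * g x).
Proof.
move=> [fr fi] [gr gi]; split.
  rewrite (_ : (fun _ => _) = (fun x => complex.Re (f x) * complex.Re (g x) -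
    complex.Im (f x) * complex.Im (g x))).
    by apply: measurable_funB; exact: measurable_funM.
  by apply/funext => x; case: (f x) => ? ?; case: (g x).
rewrite (_ : (fun _ => _) = (fun x => complex.Re (f x) * complex.Im (g x) +
    complex.Im (f x) * complex.Re (g x))).
  by apply: measurable_funD; exact: measurable_funM.
by apply/funext => x; case: (f x) => ? ?; case: (g x).
Qed.

Lemma cmeasurable_cst (c : R[i]) : cmeasurable (fun=> c).
Proof. by split; exact: measurable_cst. Qed.

Lemma cmeasurableB f g : cmeasurable f -> cmeasurable g ->
  cmeasurable (fun x => f x - g x).
Proof.
move=> mf mg; rewrite (_ : (fun _ => _) = (fun x => f x + (-1) * g x)).
  by apply: cmeasurableD => //; apply: cmeasurableM => //; exact: cmeasurable_cst.
by apply/funext => x; rewrite mulN1r.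
Qed.

Lemma cmeasurable_real (f : T -> R) : measurable_fun setT f ->
  cmeasurable (fun x => (f x)%:C).
Proof. by move=> mf; split => //=; exact: measurable_cst. Qed.

Lemma cmeasurable_sum (I : Type) (s : seq I) (f : I -> T -> R[i]) :
  (forall i, cmeasurable (f i)) -> cmeasurable (fun x => \sum_(i <- s) f i x).
Proof.
move=> mf; elim: s => [|i s IH].
  under eq_fun do rewrite big_nil; exact: cmeasurable_cst.
by under eq_fun do rewrite big_cons; exact: cmeasurableD.
Qed.

Lemma cvmeasurable_odot (xi : T -> E) (f g : T -> V) : measurable_fun setT xi ->
  cvmeasurable f -> cvmeasurable g -> cvmeasurable (fun x => odot (xi x) (f x) (g x)).
Proof.
move=> mxi /cvmeasurableE mf /cvmeasurableE mg; apply/cvmeasurableE => j.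
have mdir k : cmeasurable (fun x => (dir (xi x) ord0 k)%:C).
  by apply: cmeasurable_real; exact: measurable_dir.
have mdot (u : T -> V) : (forall k, cmeasurable (fun x => u x ord0 k)) ->
    cmeasurable (fun x => dirdot (xi x) (u x)).
  by move=> mu; apply: cmeasurable_sum => k; exact: cmeasurableM.
have mperp (u : T -> V) : (forall k, cmeasurable (fun x => u x ord0 k)) ->
    cmeasurable (fun x => perp_proj (xi x) (u x) ord0 j).
  move=> mu; rewrite (_ : (fun _ => _) = (fun x => u x ord0 j -
      dirdot (xi x) (u x) * (dir (xi x) ord0 j)%:C)).
    by apply: cmeasurableB => //; apply: cmeasurableM => //; exact: mdot.
  by apply/funext => x; rewrite /perp_proj !mxE.
rewrite (_ : (fun _ => _) = (fun x => (- (0 +i* 1) / 2%:R) *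
   (dirdot (xi x) (g x) * perp_proj (xi x) (f x) ord0 j +
    dirdot (xi x) (f x) * perp_proj (xi x) (g x) ord0 j))); last first.
  apply/funext => x; rewrite /odot [LHS]mxE; congr (_ * _).
  by rewrite [LHS]mxE; congr (_ + _); rewrite [LHS]mxE.
apply: cmeasurableM; first exact: cmeasurable_cst.
by apply: cmeasurableD; apply: cmeasurableM; (exact: mdot || exact: mperp).
Qed.

Lemma cvmeasurable_cnorm (f : T -> V) : cvmeasurable f ->
  measurable_fun setT (fun x => cnorm (f x)).
Proof.
move=> mf; apply: measurable_sqrtr => [x|].
  by apply: sumr_ge0 => j _; rewrite addr_ge0// sqr_ge0.
apply: measurable_sum => j; apply: measurable_funD; apply: measurable_funX.
  exact: (mf (j, false)).
exact: (mf (j, true)).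
Qed.

Lemma cvmeasurable_if (b : T -> bool) (f g : T -> V) : measurable_fun setT b ->
  cvmeasurable f -> cvmeasurable g -> cvmeasurable (fun x => if b x then f x else g x).
Proof.
move=> mb mf mg k.
rewrite (_ : (fun _ => _) = (fun x => if b x then rcoord k (f x) else rcoord k (g x))).
  exact: measurable_fun_ifT.
by apply/funext => x; case: ifP.
Qed.

Lemma cvmeasurable_cst (a : V) : cvmeasurable (fun=> a).
Proof. by move=> k; exact: measurable_cst. Qed.

End complex_measurability.

Lemma cvmeasurable_comp {R : realType} {d : nat} d1 d2 (T1 : measurableType d1)
    (T2 : measurableType d2) (f : T2 -> 'rV[R[i]]_d) (g : T1 -> T2) :
  cvmeasurable f -> measurable_fun setT g -> cvmeasurable (fun x => f (g x)).
Proof. by move=> mf mg k; exact: (measurableT_comp (mf k)). Qed.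

Section complex_integral.
Context {R : realType} {d : nat} {dT : measure_display} {T : measurableType dT}.
Variable mu : {measure set T -> \bar R}.
Local Notation V := 'rV[R[i]]_d.
Local Open Scope ereal_scope.

Lemma rcoord_cvintegral D (f : T -> V) k :
  rcoord k (cvintegral mu D f) = fine (\int[mu]_(x in D) (rcoord k (f x))%:E).
Proof. by case: k => j [] /=; rewrite /rcoord /cvintegral mxE. Qed.

Lemma cvintegrableP (f : T -> V) : cvintegrable mu setT f <->
  forall k, mu.-integrable setT (fun x => (rcoord k (f x))%:E).
Proof.
split=> [fi [j b]|fi j]; first by have [] := fi j; case: b.
by split; [exact: (fi (j, false))|exact: (fi (j, true))].
Qed.

Lemma cnorm_integrable (f : T -> V) : cvmeasurable f ->
  \int[mu]_x (cnorm (f x))%:E < +oo -> cvintegrable mu setT f.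
Proof.
move=> mf foo; apply/cvintegrableP => k; apply/integrableP; split.
  by apply/measurable_EFinP; exact: mf.
apply: le_lt_trans foo; apply: ge0_le_integral => //.
- by do 2 apply: measurableT_comp => //; exact: mf.
- by apply/measurable_EFinP; exact: cvmeasurable_cnorm.
- by move=> x _; rewrite lee_fin rcoord_le_cnorm.
Qed.

Lemma integrable_cnorm (f : T -> V) : cvmeasurable f -> cvintegrable mu setT f ->
  mu.-integrable setT (fun x => (cnorm (f x))%:E).
Proof.
move=> mf /cvintegrableP fi.
apply: (@le_integrable _ _ _ _ _ _ _ (fun x => \sum_k `|(rcoord k (f x))%:E|)) => //.
- by apply/measurable_EFinP; exact: cvmeasurable_cnorm.
- move=> x _ /=; rewrite sumEFin lee_fin ger0_norm; last exact: sumr_ge0.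
  by rewrite ger0_norm ?cnorm_ge0// cnorm_le_sum.
- by apply: integrable_sum => // k _; exact: integrable_abse.
Qed.

(** Expansion in the real basis reduces this to linearity of the real integral. *)
Lemma integral_real_linear (f : T -> V) (F : V -> R) : real_linear F ->
  cvintegrable mu setT f ->
  \int[mu]_x (F (f x))%:E = (F (cvintegral mu setT f))%:E.
Proof.
move=> lF /cvintegrableP fi.
transitivity (\int[mu]_x \sum_k (F (rbasis k))%:E * (rcoord k (f x))%:E).
  apply: eq_integral => x _; rewrite (real_linearE _ lF) -sumEFin.
  by apply: eq_bigr => k _; rewrite -EFinM mulrC.
rewrite integral_sum//; last by move=> k; exact: integrableZl.
rewrite (real_linearE _ lF) -sumEFin; apply: eq_bigr => k _.
rewrite integralZl// EFinM muleC rcoord_cvintegral fineK//.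
exact: integrable_fin_num.
Qed.

End complex_integral.

Section odot_integral.
Context {R : realType} {d : nat} {d1 d2 : measure_display}
  {T1 : measurableType d1} {T2 : measurableType d2}.
Variables (m1 : {sigma_finite_measure set T1 -> \bar R})
  (m2 : {sigma_finite_measure set T2 -> \bar R}).
Local Notation V := 'rV[R[i]]_d.
Variables (f : T1 -> V) (g : T2 -> V) (xi : 'rV[R]_d).
Hypotheses (mf : cvmeasurable f) (mg : cvmeasurable g).
Hypotheses (fi : cvintegrable m1 setT f) (gi : cvintegrable m2 setT g).
Local Open Scope ereal_scope.

(** Expectation factorizes through a bilinear operation of independent
    variables. *)
Lemma integral_odot k :
  (m1 \x m2).-integrable setT
    (fun p => (rcoord k (odot xi (f p.1) (g p.2)))%:E) /\
  \int[m1 \x m2]_p (rcoord k (odot xi (f p.1) (g p.2)))%:E =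
  (rcoord k (odot xi (cvintegral m1 setT f) (cvintegral m2 setT g)))%:E.
Proof.
have H : (m1 \x m2).-integrable setT
    (fun p => (rcoord k (odot xi (f p.1) (g p.2)))%:E).
  have [K K0 leK] := rcoord_odot_le k xi.
  have mF : measurable_fun setT
      (fun p : T1 * T2 => (rcoord k (odot xi (f p.1) (g p.2)))%:E).
    apply/measurable_EFinP; apply: cvmeasurable_odot => //.
      exact: (cvmeasurable_comp mf).
    exact: (cvmeasurable_comp mg).
  apply/(integrable12ltyP m1 m2 mF).
  have [fin ginn] := (integrable_cnorm mf fi, integrable_cnorm mg gi).
  apply: (@le_lt_trans _ _ (\int[m1]_x ((cnorm (f x))%:E *
      (K%:E * \int[m2]_y (cnorm (g y))%:E)))).
    apply: ge0_le_integral => //.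
    - by move=> x _; exact: integral_ge0.
    - apply: (@measurable_fun_fubini_tonelli_F _ _ _ _ _ m2
        (fun p => `|(rcoord k (odot xi (f p.1) (g p.2)))%:E|)) => //.
      exact: measurableT_comp.
    - apply: emeasurable_funM => //; apply/measurable_EFinP.
      exact: cvmeasurable_cnorm.
    - move=> x _; rewrite muleA -EFinM -ge0_integralZl//.
      + apply: ge0_le_integral => //.
        * by apply: measurableT_comp => //; exact: (measurable_fun_pair2 x mF).
        * apply: measurable_funeM; apply/measurable_EFinP; exact: cvmeasurable_cnorm.
        * by move=> y _; rewrite -EFinM lee_fin (mulrC (cnorm _)); exact: leK.
      + by apply/measurable_EFinP; exact: cvmeasurable_cnorm.
      + by move=> y _; rewrite lee_fin cnorm_ge0.
      + by rewrite lee_fin mulr_ge0 ?cnorm_ge0.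
  rewrite -(fineK (integrable_fin_num measurableT ginn)) -EFinM.
  rewrite integralZr// -(fineK (integrable_fin_num measurableT fin)) -EFinM.
  exact: ltry.
split => //.
rewrite -(integral12_prod_meas1 H) /fubini_F /=.
under eq_integral do rewrite (integral_real_linear (real_linear_odotr k xi _) gi).
by rewrite (integral_real_linear (real_linear_odotl k xi _) fi).
Qed.

End odot_integral.

(** * The space of realizations of a cascade *)

Section family_space.
Context {R : realType} {d : nat}.
Local Notation E := 'rV[R]_d.

Definition cylinder : set (set (vertex -> E * R)) :=
  [set C | exists u B, measurable B /\ C = [set p | B (p u)]].

Definition family := g_sigma_algebraType cylinder.

Lemma measurable_at (u : vertex) :
  measurable_fun setT (fun p : family => p u).
Proof. by move=> _ B mB; rewrite setTI; apply: sub_sigma_algebra; exists u, B. Qed.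

Lemma measurable_fun_family {dT} {T : measurableType dT} (f : T -> family) :
  (forall u, measurable_fun setT (fun x => f x u)) -> measurable_fun setT f.
Proof.
move=> mf; apply: (@measurability _ _ _ family _ _ cylinder) => //.
move=> _ [_ [u [B [mB ->]] <-]]; exact: mf.
Qed.

Definition subtree (b : bool) (p : family) : family := fun u => p (b :: u).

Lemma measurable_subtree b : measurable_fun setT (subtree b).
Proof. by apply: measurable_fun_family => u; exact: measurable_at. Qed.

(** Events that prescribe, vertex by vertex, the values of the family at
    finitely many generations, organized along the recursive structure of the
    tree. *)
Fixpoint box (n : nat) : set (set family) :=
  if n is m.+1 then
    [set C | exists B C1 C2, [/\ measurable B, box m C1, box m C2 &
      C = [set p | [/\ B (p [::]), C1 (subtree false p) & C2 (subtree true p)]]]]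
  else [set setT].

Lemma boxT n : box n setT.
Proof.
elim: n => [//|n IH] /=; exists setT, setT, setT; split => //.
by apply/seteqP; split.
Qed.

Lemma boxS n : box n `<=` box n.+1.
Proof.
elim: n => [_ ->|n IH _ [B [C1 [C2 [mB C1n C2n ->]]]]]; first exact: boxT.
by exists B, C1, C2; split => //; exact: IH.
Qed.

Lemma box_le n m : (n <= m)%N -> box n `<=` box m.
Proof.
move=> /subnK <-; elim: (m - n)%N => [//|k IH]; rewrite addSn.
exact: subset_trans IH (@boxS _).
Qed.

Lemma boxI n C D : box n C -> box n D -> box n (C `&` D).
Proof.
elim: n C D => [_ _ -> ->|n IH _ _ [B [C1 [C2 [mB C1n C2n ->]]]]
  [B' [D1 [D2 [mB' D1n D2n ->]]]]] /=; first by rewrite setTI.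
exists (B `&` B'), (C1 `&` D1), (C2 `&` D2); split; [exact: measurableI|exact: IH..|].
by apply/seteqP; split => p /=; [case=> -[? ? ?] [? ? ?]|case=> -[? ?] [? ?] [? ?]].
Qed.

Lemma measurable_box n C : box n C -> measurable C.
Proof.
elim: n C => [_ ->//|n IH _ [B [C1 [C2 [mB C1n C2n ->]]]]].
rewrite (_ : [set _ | _] = (fun p : family => p [::]) @^-1` B `&`
  (subtree false @^-1` C1 `&` subtree true @^-1` C2)); last first.
  by apply/seteqP; split => p /=; [case|case=> ? []].
apply: measurableI; first by rewrite -[X in measurable X]setTI; exact: measurable_at.
by apply: measurableI; rewrite -[X in measurable X]setTI;
  apply: measurable_subtree => //; exact: IH.
Qed.

Definition boxes : set (set family) := [set C | exists n, box n C].

Lemma cylinder_box u (B : set (E * R)) : measurable B ->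
  boxes [set p | B (p u)].
Proof.
move=> mB; suff : box (size u).+1 [set p | B (p u)] by exists (size u).+1.
elim: u => [|[] u IH].
- exists B, setT, setT; split => //.
  by apply/seteqP; split => p //= -[].
- exists setT, setT, [set p : family | B (p u)]; split => //; first exact: boxT.
  by apply/seteqP; split => p //= -[].
- exists setT, [set p : family | B (p u)], setT; split => //; first exact: boxT.
  by apply/seteqP; split => p //= -[].
Qed.

(** A cylinder over the vertex [u] is a box of depth one more than the length of
    [u], hence boxes generate the product sigma-algebra. Being stable under
    intersection and recursive, they support both the Dynkin argument and the
    induction on generations. *)
Lemma measurable_family_boxes : @measurable _ family = <<s boxes >>.
Proof.
apply/seteqP; split; apply: smallest_sub.
- exact: smallest_sigma_algebra.
- move=> _ [u [B [mB ->]]]; apply: sub_sigma_algebra; exact: cylinder_box.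
- exact: sigma_algebra_measurable.
- by move=> C [n /measurable_box].
Qed.

Lemma setI_closed_boxes : setI_closed boxes.
Proof.
move=> C D [n Cn] [m Dm]; exists (maxn n m); apply: boxI.
  exact: box_le (leq_maxl _ _) _ Cn.
exact: box_le (leq_maxr _ _) _ Dm.
Qed.

End family_space.

(** * The solution process as a function of the realization *)

Section recursion.
Context {R : realType} {d : nat}.
Local Notation E := 'rV[R]_d.
Local Notation V := 'rV[R[i]]_d.
Local Notation fam := (@family R d).
Variable chi0 : E -> V.

(** Every path from the root to generation [n] has total waiting time more than
    [s]; the explosion time exceeds [s] exactly when this happens for some [n]. *)
Fixpoint survives (n : nat) (s : R) (p : fam) : bool :=
  if n is m.+1 then
    survives m (s - (p [::]).2) (subtree false p) &&
    survives m (s - (p [::]).2) (subtree true p)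
  else s < (p [::]).2.

(** The recursion for the solution process cut at generation [n], where the
    initial data are used whatever the waiting times; on the event
    [survives n s p] the cut is never reached with time left. *)
Fixpoint truncated_process (n : nat) (s : R) (p : fam) : V :=
  if n is m.+1 then
    if s <= (p [::]).2 then chi0 (p [::]).1
    else odot (p [::]).1
      (truncated_process m (s - (p [::]).2) (subtree false p))
      (truncated_process m (s - (p [::]).2) (subtree true p))
  else chi0 (p [::]).1.

Lemma survivesP n s p : survives n s p <->
  (forall v : n.-tuple bool, s < \sum_(j < n.+1) (p (take j v)).2).
Proof.
have split_sum m (q : fam) (b : bool) (v : seq bool) :
    \sum_(j < m.+2) (q (take j (b :: v))).2 =
    (q [::]).2 + \sum_(j < m.+1) (subtree b q (take j v)).2.
  by rewrite big_ord_recl take0; congr (_ + _); apply: eq_bigr.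
elim: n s p => [|n IH] s p /=.
  split=> [sT v|/(_ [tuple])]; last by rewrite big_ord1.
  by rewrite big_ord1 take0.
split=> [/andP[/IH s0 /IH s1] v|sv].
  rewrite (tuple_eta v); case: (thead v) => /=; rewrite split_sum -ltrBlDl.
    exact: (s1 [tuple of behead v]).
  exact: (s0 [tuple of behead v]).
by apply/andP; split; apply/IH => v; rewrite ltrBlDl -split_sum;
  [exact: (sv [tuple of false :: v])|exact: (sv [tuple of true :: v])].
Qed.

Section model.
Context {dO : measure_display} {Omega : measurableType dO}.
Variables (W : E -> vertex -> Omega -> E) (tau : E -> vertex -> Omega -> R).
Variables (xi : E) (omega : Omega).
Local Notation path v := (subfamily W tau xi v omega).

Lemma subtree_subfamily b v : subtree b (path v) = path (rcons v b).
Proof. by apply/funext => u; rewrite /subtree /subfamily cat_rcons. Qed.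

Lemma lt_explosion_timeP s :
  (s%:E < explosion_time tau xi omega)%E <-> exists n, survives n s (path [::]).
Proof.
split=> [/ereal_sup_gt[_ [n _ <-] sn]|[n /survivesP sn]].
  exists n; apply/survivesP => v; rewrite -lte_fin; apply: lt_le_trans sn _.
  exact: bigmin_le_cond.
apply: (@lt_le_trans _ _ (\big[Order.min/+oo%E]_(v : n.-tuple bool)
  (\sum_(j < n.+1) tau xi (take j v) omega)%:E)).
  by apply: lt_bigmin => [|v _]; rewrite ?ltry// lte_fin; exact: sn.
by apply: ereal_sup_ubound; exists n.
Qed.

Lemma X_eval_truncated n v s : survives n s (path v) ->
  X_eval W tau chi0 xi omega v s (truncated_process n s (path v)).
Proof.
elim: n v s => [|n IH] v s /=; rewrite /subfamily cats0 -/(path v).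
  by move=> sT; apply: X_stop; exact: ltW.
move=> /andP[s0 s1]; case: leP => sT; first exact: X_stop.
move: s0 s1; rewrite !subtree_subfamily => s0 s1.
by apply: X_branch => //; exact: IH.
Qed.

Lemma solution_process_truncated n s : survives n s (path [::]) ->
  solution_process W tau chi0 xi s omega = truncated_process n s (path [::]).
Proof.
move=> sn; rewrite /solution_process ifT; last by apply/lt_explosion_timeP; exists n.
case: xgetP => [x _ xE|/(_ _ (X_eval_truncated sn))//].
exact: X_eval_unique xE (X_eval_truncated sn).
Qed.

Lemma solution_process_eq0 s : (forall n, ~~ survives n s (path [::])) ->
  solution_process W tau chi0 xi s omega = 0.
Proof.
move=> sn; rewrite /solution_process ifF//; apply/negP => /lt_explosion_timeP[n].
by apply/negP.
Qed.

End model.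

(** The solution process depends on the sample only through the realized family.
    This is the dependence itself, namely the solution process of the coordinate
    cascade; there the wave number of the root is part of the realization, so the
    initial one may be any value, here 0. *)
Definition canonical_process : R -> fam -> V :=
  solution_process (fun _ v (p : fam) => (p v).1) (fun _ v (p : fam) => (p v).2)
    chi0 0.
Local Notation X := canonical_process.

Let subfamily_canonical (p : fam) :
  subfamily (fun _ v (q : fam) => (q v).1) (fun _ v (q : fam) => (q v).2) (0 : E)
    [::] p = p.
Proof. by apply/funext => u; rewrite /subfamily -surjective_pairing. Qed.

Lemma canonical_process_truncated n s p : survives n s p ->
  X s p = truncated_process n s p.
Proof.
move=> sn; rewrite /X (@solution_process_truncated _ _ _ _ _ _ n)//;
by rewrite subfamily_canonical.
Qed.

Lemma canonical_process_eq0 s p : (forall n, ~~ survives n s p) -> X s p = 0.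
Proof.
by move=> sn; rewrite /X solution_process_eq0// => n; rewrite subfamily_canonical.
Qed.

Lemma solution_processE {dO : measure_display} {Omega : measurableType dO}
    (W : E -> vertex -> Omega -> E) (tau : E -> vertex -> Omega -> R) xi s omega :
  solution_process W tau chi0 xi s omega = X s (subfamily W tau xi [::] omega).
Proof.
have [[n sn]|/forallNP sn] :=
    pselect (exists n, survives n s (subfamily W tau xi [::] omega)).
  by rewrite (solution_process_truncated sn) (canonical_process_truncated sn).
by rewrite solution_process_eq0 ?canonical_process_eq0// => n; apply/negP.
Qed.

Lemma survives_le n m s p : (n <= m)%N -> (forall u, 0 <= (p u).2) ->
  survives n s p -> survives m s p.
Proof.
move=> /subnK <- p0; elim: (m - n)%N => [//|k IH] /IH; rewrite addSn.
elim: (k + n)%N s p p0 {IH} => [|l IH] s p p0 sl.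
  by apply/andP; split; rewrite /= ltrBlDl; apply: lt_le_trans sl _; rewrite lerDl;
    exact: p0.
by case/andP: sl => s0 s1; apply/andP; split; apply: IH => // u; exact: p0.
Qed.

Lemma canonical_process_stop s p : (forall v, 0 < (p v).2) -> s <= (p [::]).2 ->
  X s p = chi0 (p [::]).1.
Proof.
move=> p0 sT; rewrite (@canonical_process_truncated 1) /= ?sT//.
by apply/andP; split; rewrite ltrBlDl; apply: le_lt_trans sT _; rewrite ltrDl;
  exact: p0.
Qed.

(** For positive waiting times, the tree survives past [s] if and only if both
    subtrees survive the remaining time. When one of them does not, its process
    is 0 by convention and so is the product. *)
Lemma canonical_process_branch s p : (forall v, 0 < (p v).2) -> (p [::]).2 < s ->
  X s p = odot (p [::]).1 (X (s - (p [::]).2) (subtree false p))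
                          (X (s - (p [::]).2) (subtree true p)).
Proof.
move=> p0 Ts; have [[n]|/forallNP sn] := pselect (exists n, survives n s p).
  case: n => [|n] sn; first by move: (lt_trans Ts sn); rewrite ltxx.
  rewrite (canonical_process_truncated sn) /= leNgt Ts/=.
  by case/andP: sn => s0 s1; rewrite !(@canonical_process_truncated n).
rewrite canonical_process_eq0; last by move=> n; apply/negP.
have [[n s0]|/forallNP s0] := pselect (exists n,
    survives n (s - (p [::]).2) (subtree false p)); last first.
  by rewrite canonical_process_eq0 ?odot0l// => n; apply/negP.
rewrite [X _ (subtree true p)]canonical_process_eq0 ?odot0r// => m; apply/negP => s1.
apply: (sn (maxn n m).+1); apply/andP; split.
  by apply: survives_le s0; [exact: leq_maxl|move=> u; exact/ltW/p0].
by apply: survives_le s1; [exact: leq_maxr|move=> u; exact/ltW/p0].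
Qed.

Hypothesis mchi0 : cvmeasurable chi0.

Let measurable_root : measurable_fun setT (fun q : R * fam => q.2 [::]).
Proof. by apply: (measurableT_comp (measurable_at [::])); exact: measurable_snd. Qed.

Let measurable_rest b : measurable_fun setT
  (fun q : R * fam => (q.1 - (q.2 [::]).2, subtree b q.2)).
Proof.
apply: measurable_fun_pair.
  by apply: measurable_funB => //; exact: measurableT_comp.
by apply: measurableT_comp => //; exact: measurable_subtree.
Qed.

Let measurable_survives n : measurable_fun setT (fun q : R * fam => survives n q.1 q.2).
Proof.
elim: n => [|n IH] /=.
  by apply: measurable_fun_ltr => //; exact: measurableT_comp.
by apply: measurable_and; exact: (measurableT_comp IH (measurable_rest _)).
Qed.

Let measurable_truncated n : cvmeasurable (fun q : R * fam => truncated_process n q.1 q.2).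
Proof.
elim: n => [|n IH] /=.
  by apply: (cvmeasurable_comp mchi0); exact: measurableT_comp.
apply: cvmeasurable_if.
- by apply: measurable_fun_ler => //; exact: measurableT_comp.
- by apply: (cvmeasurable_comp mchi0); exact: measurableT_comp.
- apply: cvmeasurable_odot; first exact: measurableT_comp.
    exact: (cvmeasurable_comp IH (measurable_rest _)).
  exact: (cvmeasurable_comp IH (measurable_rest _)).
Qed.

(** On each of the countably many measurable events [survives n], the process is
    the measurable truncated process; outside of them it is 0. *)
Lemma measurable_canonical_process :
  cvmeasurable (fun q : R * fam => X q.1 q.2).
Proof.
move=> k _ B mB; rewrite setTI.
pose S n := [set q : R * fam | survives n q.1 q.2].
have mS n : measurable (S n).
  by rewrite -[X in measurable X]setTI; exact: measurable_survives.
rewrite (_ : _ @^-1` _ =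
    \bigcup_n (S n `&` (fun q => rcoord k (truncated_process n q.1 q.2)) @^-1` B)
    `|` ((~` \bigcup_n S n) `&` [set q | B (rcoord k (0 : V))])).
  apply: measurableU.
    apply: bigcup_measurable => n _; apply: measurableI => //.
    by rewrite -[X in measurable X]setTI; exact: measurable_truncated.
  have [B0|B0] := pselect (B (rcoord k (0 : V))).
    rewrite (_ : [set _ | _] = setT) ?setIT; last by apply/seteqP; split.
    by apply: measurableC; exact: bigcup_measurable.
  by rewrite (_ : [set _ | _] = set0) ?setI0//; apply/seteqP; split.
apply/seteqP; split => [q /= Bq|q /= [[n _ [/= sn]]|[sn]]].
- have [[n sn]|/forallNP sn] := pselect (exists n, survives n q.1 q.2).
    by left; exists n => //; split => //=; rewrite -canonical_process_truncated.
  right; split; first by move=> [n _ /sn].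
  by move: Bq; rewrite canonical_process_eq0// => n; apply/negP.
- by rewrite (canonical_process_truncated sn).
- rewrite canonical_process_eq0// => n; apply/negP => sn'; apply: sn; by exists n.
Qed.

End recursion.

(** * Density of the first splitting *)

Section splitting_density.
Context {R : realType} {d : nat}.
Hypothesis d_gt0 : (0 < d)%N.
Local Notation E := 'rV[R]_d.
Variable h : E -> R.
Hypothesis h_kernel : standard_majorizing_kernel h.

(** The value of [h] at the origin is arbitrary, possibly negative. Resetting it
    to 0 changes the offspring density on a null set only, and makes it
    nonnegative and jointly measurable everywhere. *)
Definition kernel_off0 (x : E) : R := if x == 0 then 0 else h x.

Definition offspring_density (xi eta : E) : R :=
  branching_density kernel_off0 eta xi.

Lemma kernel_off0_ge0 x : 0 <= kernel_off0 x.
Proof. by rewrite /kernel_off0; case: eqVneq => // x0; exact/ltW/(kernel_gt0 h_kernel). Qed.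

Lemma measurable_kernel_off0 {dT} {T : measurableType dT} (f : T -> E) :
  measurable_fun setT f -> measurable_fun setT (fun x => kernel_off0 (f x)).
Proof.
move=> mf; apply: (measurableT_comp _ mf).
rewrite -(setvU [set (0 : E)]); apply/measurable_funU.
- by apply: measurableC; exact: measurable_rowvec1.
- exact: measurable_rowvec1.
split; last exact: measurable_fun_set1.
apply: (@eq_measurable_fun _ _ _ _ _ h) => [x|].
  by rewrite inE/= => /eqP/negPf x0; rewrite /kernel_off0 x0.
rewrite (_ : ~` _ = [set x : E | x != 0]); first exact: (kernel_measurable h_kernel).
by apply/seteqP; split => x /eqP.
Qed.

Lemma offspring_density_ge0 xi eta : 0 <= offspring_density xi eta.
Proof.
by rewrite /offspring_density /branching_density divr_ge0// mulr_ge0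
  ?kernel_off0_ge0 ?enorm_ge0.
Qed.

Lemma measurable_offspring_density {dT} {T : measurableType dT} (f g : T -> E) :
  measurable_fun setT f -> measurable_fun setT g ->
  measurable_fun setT (fun x => offspring_density (f x) (g x)).
Proof.
move=> mf mg; apply: measurable_funM.
  apply: measurable_funM; first exact: measurable_kernel_off0.
  by apply: measurable_kernel_off0; exact: measurable_rowvecB.
apply: measurable_Vr => [x|]; first by rewrite mulr_ge0 ?kernel_off0_ge0 ?enorm_ge0.
by apply: measurable_funM; [exact: measurable_enorm|exact: measurable_kernel_off0].
Qed.

Lemma offspring_densityE xi eta : xi != 0 -> eta != 0 -> eta != xi ->
  offspring_density xi eta = branching_density h eta xi.
Proof.
move=> xi0 eta0 etaxi; rewrite /offspring_density /branching_density /kernel_off0.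
by rewrite (negPf xi0) (negPf eta0) subr_eq0 eq_sym (negPf etaxi).
Qed.

Lemma ae_offspring_density xi : xi != 0 ->
  {ae lebesgue_rV d, forall eta, offspring_density xi eta = branching_density h eta xi}.
Proof.
move=> xi0; exists ([set 0] `|` [set xi]); split.
- by apply: measurableU; exact: measurable_rowvec1.
- by rewrite null_set_setU => //; try exact: measurable_rowvec1; exact: lebesgue_rV1.
- move=> eta /= H; have [->|eta0] := eqVneq eta 0; first by left.
  by right; apply: contra_notP H => /eqP; exact: offspring_densityE.
Qed.

(** Joint density of the waiting time and of the first child. *)
Definition split_density (xi : E) (y : R * E) : R :=
  exponential_pdf (enorm xi ^+ 2) y.1 * offspring_density xi y.2.

Lemma split_density_ge0 xi y : 0 <= split_density xi y.
Proof.
by rewrite mulr_ge0 ?offspring_density_ge0// exponential_pdf_ge0// sqr_ge0.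
Qed.

Lemma measurable_exponential_pdf2 {dT} {T : measurableType dT} (f g : T -> R) :
  measurable_fun setT f -> measurable_fun setT g ->
  measurable_fun setT (fun x => exponential_pdf (f x) (g x)).
Proof.
move=> mf mg; rewrite (_ : (fun _ => _) = (fun x =>
    if 0 <= g x then f x * expR (- f x * g x) else 0)).
  apply: measurable_fun_ifT => //; first exact: measurable_fun_ler.
  apply: measurable_funM => //; apply: measurableT_comp => //.
  by apply: measurable_funM => //; exact: measurable_funN.
apply/funext => x; case: ifPn => g0; first by rewrite exponential_pdfE.
by rewrite lt0_exponential_pdf// ltNge.
Qed.

Lemma measurable_split_density {dT} {T : measurableType dT} (f : T -> E)
    (g : T -> R * E) : measurable_fun setT f -> measurable_fun setT g ->
  measurable_fun setT (fun x => split_density (f x) (g x)).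
Proof.
move=> mf mg; apply: measurable_funM.
  apply: measurable_exponential_pdf2; last exact: measurableT_comp.
  by apply: measurable_funX; exact: measurable_enorm.
by apply: measurable_offspring_density => //; exact: measurableT_comp.
Qed.

Lemma measurable_split_density1 xi : measurable_fun setT (split_density xi).
Proof. by apply: measurable_split_density => //; exact: measurable_cst. Qed.

Local Notation Y := (measurableTypeR R * E)%type.

Definition lebesgue_time_space : {measure set Y -> \bar R} :=
  product_measure1 (@lebesgue_measure R) (lebesgue_rV d).

Definition split_law xi : {measure set Y -> \bar R} :=
  mdensity lebesgue_time_space (measurable_split_density1 xi)
    (split_density_ge0 xi).

Lemma split_law_rect xi (B : set R) (C : set E) : xi != 0 ->
  measurable B -> measurable C ->
  split_law xi (B `*` C) = (exponential_prob (enorm xi ^+ 2) B *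
    \int[lebesgue_rV d]_(eta in C) (branching_density h eta xi)%:E)%E.
Proof.
move=> xi0 mB mC.
rewrite /split_law /mdensity/= /density_measure integral_mkcond.
pose F (y : Y) : \bar R := (((fun z => (split_density xi z)%:E) \_ (B `*` C)) y)%E.
have mF : measurable_fun setT F.
  apply/(measurable_restrictT _ (measurableX mB mC)).
  by apply/measurable_EFinP; apply: measurable_funTS; exact: measurable_split_density1.
rewrite (@fubini_tonelli1 _ _ _ _ _ lebesgue_measure (lebesgue_rV d) F)//; last first.
  by move=> y; rewrite /F patchE; case: ifP => // _; rewrite lee_fin split_density_ge0.
rewrite /fubini_F /F.
rewrite (ae_eq_integral_in _ (g := fun eta => (offspring_density xi eta)%:E)); last first.
  by apply: filterS (ae_offspring_density xi0) => eta /= ->.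
rewrite /exponential_prob.
set I := (\int[_]_(eta in C) _)%E.
have I0 : (0 <= I)%E by apply: integral_ge0 => eta _; rewrite lee_fin offspring_density_ge0.
rewrite [in RHS]integral_mkcond -ge0_integralZr//.
- apply: eq_integral => s _; rewrite patchE /I.
  have [sB|sB] := ifPn.
    rewrite [in RHS]integral_mkcond -ge0_integralZl//.
    + apply: eq_integral => eta _; rewrite !patchE in_setX sB/=.
      by case: ifP => _; rewrite ?mule0// /split_density EFinM.
    + apply/(measurable_restrictT _ mC); apply: measurable_funTS; apply/measurable_EFinP.
      by apply: measurable_offspring_density => //; exact: measurable_cst.
    + by move=> eta _; rewrite patchE; case: ifP => // _; rewrite lee_fin offspring_density_ge0.
    + by rewrite lee_fin exponential_pdf_ge0// sqr_ge0.
  rewrite mul0e integral0_eq// => eta _.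
  by rewrite patchE in_setX (negPf sB).
- apply/(measurable_restrictT _ mB); apply: measurable_funTS; apply/measurable_EFinP.
  exact: measurable_exponential_pdf.
- by move=> s _; rewrite patchE; case: ifP => // _; rewrite lee_fin exponential_pdf_ge0// sqr_ge0.
Qed.

End splitting_density.

(** * The law of the cascade as a kernel *)

Section cascade_laws.
Context {R : realType} {d : nat}.
Hypothesis d_gt0 : (0 < d)%N.
Local Notation E := 'rV[R]_d.
Local Notation fam := (@family R d).
Local Notation Y := (measurableTypeR R * E)%type.
Variable h : E -> R.
Hypothesis h_kernel : standard_majorizing_kernel h.
Context {dO : measure_display} {Omega : measurableType dO}.
Variables (P : E -> probability Omega R).
Variables (W : E -> vertex -> Omega -> E) (tau : E -> vertex -> Omega -> R).
Hypothesis cascade : is_cascade h P W tau.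
Local Open Scope ereal_scope.

Definition first_split xi omega : Y :=
  (tau xi [::] omega, W xi (child1 [::]) omega).

Lemma measurable_first_split xi : xi != 0%R -> measurable_fun setT (first_split xi).
Proof.
by move=> xi0; apply: measurable_fun_pair;
  [exact: (cascade_measurableT cascade)|exact: (cascade_measurableW cascade)].
Qed.

Lemma law_first_split xi (S : set Y) : xi != 0%R -> measurable S ->
  P xi (first_split xi @^-1` S) = split_law h_kernel xi S.
Proof.
move=> xi0 mS.
have mf := measurable_first_split xi0.
apply: (@finite_measure_eq_rect _ _ _ _ _ (giry_map mf (P xi))
  (split_law h_kernel xi)) => //.
  by apply: (@le_lt_trans _ _ 1); [exact: sprobability_setT|exact: ltry].
move=> B C mB mC; rewrite split_law_rect//.
transitivity (P xi (W xi [::] @^-1` setT `&` tau xi [::] @^-1` B `&`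
    W xi (child1 [::]) @^-1` C)).
  by rewrite /giry_map/= /pushforward; congr (P xi _); apply/seteqP; split => w /=; tauto.
rewrite (cascade_split cascade)// preimage_setT.
set c := RHS.
transitivity (\int[P xi]_(omega in setT) (cst c omega)).
  apply: ae_eq_integral_in; apply: filterS (cascade_root cascade xi0) => w /= -> _.
  by [].
rewrite integral_cst//; apply: etrans (mule1 c).
by congr (_ * _); exact: probability_setT.
Qed.

Lemma integral_first_split xi (g : Y -> \bar R) : xi != 0%R ->
  measurable_fun setT g -> (forall y, 0 <= g y) ->
  \int[P xi]_omega g (first_split xi omega) =
  \int[lebesgue_time_space]_y (g y * (split_density h xi y)%:E).
Proof.
move=> xi0 mg g0.
transitivity (\int[split_law h_kernel xi]_y g y); last first.
  exact: ge0_integral_mdensity.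
apply/esym; apply: (integral_pushforwardT (mu := P xi) (nu := split_law h_kernel xi)) => //.
  exact: measurable_first_split.
by move=> A mA; exact/esym/law_first_split.
Qed.

Lemma ae_first_child_neq xi v : xi != 0%R ->
  {ae P xi, forall omega, W xi (child1 [::]) omega != v}.
Proof.
move=> xi0; exists (W xi (child1 [::]) @^-1` [set v]); split.
- rewrite -[X in measurable X]setTI; apply: (cascade_measurableW cascade) => //.
  exact: measurable_rowvec1.
- have -> : W xi (child1 [::]) @^-1` [set v] = first_split xi @^-1` (setT `*` [set v]).
    by apply/seteqP; split => w /=; [|case].
  rewrite law_first_split//; last by apply: measurableX => //; exact: measurable_rowvec1.
  rewrite split_law_rect//; last exact: measurable_rowvec1.
  rewrite [X in _ * X](ae_eq_integral_in _ (g := cst 0)) ?integral0 ?mule0//.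
  exists [set v]; split; [exact: measurable_rowvec1|exact: lebesgue_rV1|].
  by move=> x /= /not_implyP[].
- by move=> w /= H; apply/eqP/negPn/negP.
Qed.

(** Nothing is known about the cascade started at 0, which is replaced by a
    constant so that the law is a kernel on the whole space. *)
Definition sample_family xi omega : fam :=
  if xi == 0%R then (fun=> (0%R, 0%R)) else subfamily W tau xi [::] omega.

Lemma measurable_subfamily xi v : xi != 0%R ->
  measurable_fun setT (fun omega => subfamily W tau xi v omega : fam).
Proof.
move=> xi0; apply: measurable_fun_family => u; apply: measurable_fun_pair.
  exact: (cascade_measurableW cascade).
exact: (cascade_measurableT cascade).
Qed.

Lemma measurable_sample_family xi : measurable_fun setT (sample_family xi).
Proof.
rewrite /sample_family; case: eqVneq => [_|xi0]; first exact: measurable_cst.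
exact: measurable_subfamily.
Qed.

Definition family_law xi : giry fam R := giry_map (measurable_sample_family xi) (P xi).

Lemma family_lawE xi (C : set fam) : xi != 0%R ->
  family_law xi C = cascade_law P W tau xi C.
Proof.
move=> xi0; rewrite /family_law/= /giry_map /pushforward /cascade_law/=.
by rewrite /sample_family (negPf xi0).
Qed.

Lemma family_lawT xi : family_law xi setT = 1.
Proof. exact: probability_setT. Qed.

(** The branching property, with the wave numbers of the root and of the second
    child replaced by their almost sure values. The laws of the two subtrees
    become kernels evaluated at the first child, which is almost surely neither 0
    nor [xi], so that neither subtree starts at 0. *)
Lemma law_branch xi (U : set (E * R * E)) (C1 C2 : set fam) : xi != 0%R ->
  measurable U -> measurable C1 -> measurable C2 ->
  P xi [set omega | [/\ U (W xi [::] omega, tau xi [::] omega,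
                           W xi (child1 [::]) omega),
     C1 (subfamily W tau xi (child1 [::]) omega) &
     C2 (subfamily W tau xi (child2 [::]) omega)]] =
  \int[P xi]_omega ((\1_U (xi, (first_split xi omega).1, (first_split xi omega).2))%:E *
    (family_law (first_split xi omega).2 C1 *
     family_law (xi - (first_split xi omega).2)%R C2)).
Proof.
move=> xi0 mU mC1 mC2.
have := cascade_branch cascade [::] xi0 mU mC1 mC2.
rewrite /= (_ : _ `&` _ = [set omega | [/\ U (W xi [::] omega,
     tau xi [::] omega, W xi (child1 [::]) omega),
     C1 (subfamily W tau xi (child1 [::]) omega) &
     C2 (subfamily W tau xi (child2 [::]) omega)]]); last first.
  by apply/seteqP; split => w /=; [case=> -[]|case].
move=> ->; rewrite integral_mkcond; apply: ae_eq_integralT.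
apply: filterS3 (cascade_root cascade xi0) (cascade_child2 cascade [::] xi0)
  (filterI (ae_first_child_neq 0%R xi0) (ae_first_child_neq xi xi0)) => w.
move=> W0 W2 [W10 W1xi]; rewrite patchE indicE.
have [/set_mem/= Uw|Uw] := ifPn.
  rewrite [_ \in U](_ : _ = true); last by apply/mem_set; move: Uw; rewrite W0.
  by rewrite mul1e !family_lawE ?W2 ?W0// subr_eq0 eq_sym.
rewrite [_ \in U](_ : _ = false) ?mul0e//; apply/negP => /set_mem Uw'.
by move/negP: Uw; apply; apply/mem_set => /=; rewrite W0.
Qed.

Lemma measurable_integral_time_space {dT} {T : measurableType dT}
    (G : T * Y -> \bar R) : measurable_fun setT G -> (forall p, 0 <= G p) ->
  measurable_fun setT (fun x => \int[@lebesgue_time_space R d]_y G (x, y)).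
Proof.
move=> mG G0.
rewrite (_ : (fun _ => _) = (fun x => \int[@lebesgue_measure R]_s
    \int[lebesgue_rV d]_eta G (x, (s, eta)))); last first.
  apply/funext => x; apply: (@fubini_tonelli1 _ _ _ _ _ lebesgue_measure
    (lebesgue_rV d) (fun y => G (x, y))) => //.
  exact: measurable_fun_pair2.
apply: (@measurable_fun_fubini_tonelli_F _ _ _ _ _ lebesgue_measure
  (fun q : T * measurableTypeR R => \int[lebesgue_rV d]_eta G (q.1, (q.2, eta)))).
  apply: (@measurable_fun_fubini_tonelli_F _ _ _ _ _ (lebesgue_rV d)
    (fun q : (T * measurableTypeR R) * E => G (q.1.1, (q.1.2, q.2)))) => //.
  apply: (measurableT_comp mG); apply: measurable_fun_pair.
    exact: (measurableT_comp (@measurable_fst _ _ T (measurableTypeR R)) (@measurable_fst _ _ _ E)).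
  apply: measurable_fun_pair => //.
  exact: (measurableT_comp (@measurable_snd _ _ T (measurableTypeR R)) (@measurable_fst _ _ _ E)).
by move=> q; exact: integral_ge0.
Qed.

(** Measurable dependence on the starting point comes from branching. By
    [law_branch] and the known density
    of the first splitting, the probability of a box is an integral of the
    probabilities of two boxes of smaller depth, which is measurable in [xi] by
    Tonelli's theorem; Dynkin's lemma extends this from boxes to all events. *)
Lemma measurable_family_law_set (A : set fam) : measurable A ->
  measurable_fun setT (fun xi => family_law xi A).
Proof.
rewrite measurable_family_boxes; apply: (@dynkin_induction _ fam boxes
  (fun C => measurable_fun setT (fun xi => family_law xi C))).
- exact: measurable_family_boxes.
- exact: setI_closed_boxes.
- by under eq_fun do rewrite family_lawT; exact: measurable_cst.
- move=> C [n]; elim: n C => [|n IH] C.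
    by move=> ->; under eq_fun do rewrite family_lawT; exact: measurable_cst.
  move=> [B [C1 [C2 [mB bC1 bC2 CE]]]].
  have [mC1 mC2] := (measurable_box bC1, measurable_box bC2).
  pose g (p : E * Y) : \bar R := (\1_B (p.1, p.2.1))%:E *
    (family_law p.2.2 C1 * family_law (p.1 - p.2.2)%R C2).
  have mg : measurable_fun setT g.
    have m1 : measurable_fun setT (fun p : E * Y => (p.1, p.2.1) : E * R).
      by apply: measurable_fun_pair => //; exact: measurableT_comp.
    have m22 : measurable_fun setT (fun p : E * Y => p.2.2) by exact: measurableT_comp.
    apply: emeasurable_funM.
      apply/measurable_EFinP; apply: (measurableT_comp _ m1).
      exact: measurable_indic.
    apply: emeasurable_funM; first exact: (measurableT_comp (IH _ bC1) m22).
    by apply: (measurableT_comp (IH _ bC2)); exact: measurable_rowvecB.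
  have g0 p : 0 <= g p by rewrite !mule_ge0// lee_fin.
  pose G (p : E * Y) : \bar R := g p * (split_density h p.1 p.2)%:E.
  have mG : measurable_fun setT G.
    by apply: emeasurable_funM => //; apply/measurable_EFinP; exact: measurable_split_density.
  have G0 p : 0 <= G p by rewrite !mule_ge0// lee_fin; exact: split_density_ge0.
  rewrite (_ : (fun _ => _) = (fun xi => if xi == 0%R then family_law 0%R C
      else \int[lebesgue_time_space]_y G (xi, y))); last first.
    apply/funext => xi; case: eqVneq => [->//|xi0].
    rewrite family_lawE// /cascade_law CE.
    pose U : set (E * R * E) := [set y | B y.1].
    have mU : measurable U.
      rewrite -[X in measurable X]setTI.
      by have := @measurable_fst _ _ (E * R)%type E measurableT _ mB.
    have := law_branch xi0 mU mC1 mC2.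
    rewrite (_ : [set _ | _] = [set omega | [set p : fam | [/\ B (p [::]),
        C1 (subtree false p) & C2 (subtree true p)]] (subfamily W tau xi [::] omega)]).
      move=> ->; apply: (integral_first_split xi0 (g := fun y => g (xi, y))) => //.
      exact: measurable_fun_pair2.
    by apply/seteqP; split => w /=; rewrite !subtree_subfamily.
  apply: measurable_fun_ifT; [exact: measurable_rowvec_eq|exact: measurable_cst|].
  exact: measurable_integral_time_space.
- move=> S mS IH.
  rewrite (_ : (fun _ => _) = (fun xi => 1 - family_law xi S)).
    by apply: emeasurable_funB => //; exact: measurable_cst.
  apply/funext => xi.
  apply: (probability_setC (P xi) (A := sample_family xi @^-1` S)).
  by rewrite -[X in measurable X]setTI; exact: measurable_sample_family.
- move=> F mF tF IH.
  rewrite (_ : (fun _ => _) = (fun xi => \sum_(0 <= k <oo) family_law xi (F k))).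
    by apply: ge0_emeasurable_sum => // k x _ _; exact: measure_ge0.
  apply/funext => xi; rewrite measure_semi_bigcup//; exact: bigcup_measurable.
Qed.

Lemma measurable_family_law : measurable_fun setT family_law.
Proof.
apply: measurable_giry_codensity => // B mB; exact: measurable_family_law_set.
Qed.

End cascade_laws.

(** * Conditioning on the first splitting *)

Section first_step.
Context {R : realType} {d : nat}.
Hypothesis d_gt0 : (0 < d)%N.
Local Notation E := 'rV[R]_d.
Local Notation fam := (@family R d).
Local Notation Y := (measurableTypeR R * E)%type.
Variable h : E -> R.
Hypothesis h_kernel : standard_majorizing_kernel h.
Context {dO : measure_display} {Omega : measurableType dO}.
Variables (P : E -> probability Omega R).
Variables (W : E -> vertex -> Omega -> E) (tau : E -> vertex -> Omega -> R).
Hypothesis cascade : is_cascade h P W tau.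
Local Open Scope ereal_scope.

Local Notation law := (family_law cascade).
Let mlaw := measurable_family_law d_gt0 h_kernel cascade.
Let fs := (first_split W tau).

Definition branch_law xi (y : Y) : giry (fam * fam)%type R :=
  giry_prod (law y.2, law (xi - y.2)%R).

Lemma measurable_branch_law xi : measurable_fun setT (branch_law xi).
Proof.
apply: (measurableT_comp measurable_giry_prod); apply: measurable_fun_pair.
  exact: (measurableT_comp mlaw).
by apply: (measurableT_comp mlaw); exact: measurable_rowvecB.
Qed.

(* Law of the first splitting and of the two subtrees when the former is
   frozen at y: integrands may then depend on y. *)
Let graph_law xi (y : Y) : giry (Y * (fam * fam))%type R :=
  giry_prod (giry_ret y, branch_law xi y).

Let measurable_graph_law xi : measurable_fun setT (graph_law xi).
Proof.
apply: (measurableT_comp measurable_giry_prod); apply: measurable_fun_pair.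
  exact: measurable_giry_ret.
exact: measurable_branch_law.
Qed.

Let integral_graph_law xi y (f : Y * (fam * fam) -> \bar R) :
  measurable_fun setT f -> (forall p, 0 <= f p) ->
  giry_int (graph_law xi y) f = \int[branch_law xi y]_z f (y, z).
Proof.
move=> mf f0; rewrite /graph_law giry_int_prod1// giry_int_ret//.
exact: (@measurable_fun_fubini_tonelli_F _ _ _ _ _ (branch_law xi y) f).
Qed.

Lemma measurable_integral_branch_law xi (f : Y * (fam * fam) -> \bar R) :
  measurable_fun setT f -> (forall p, 0 <= f p) ->
  measurable_fun setT (fun y => \int[branch_law xi y]_z f (y, z)).
Proof.
move=> mf f0; under eq_fun do rewrite -integral_graph_law//.
exact: (measurableT_comp (measurable_giry_int mf f0) (measurable_graph_law xi)).
Qed.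

Definition first_step xi omega : Y * (fam * fam) :=
  (fs xi omega, (subfamily W tau xi (child1 [::]) omega,
                 subfamily W tau xi (child2 [::]) omega)).

Lemma measurable_first_step xi : xi != 0%R -> measurable_fun setT (first_step xi).
Proof.
move=> xi0; apply: measurable_fun_pair; first exact: (measurable_first_split cascade).
by apply: measurable_fun_pair; exact: (measurable_subfamily cascade).
Qed.

(* On rectangles this is the branching property. *)
Let law_first_step xi (xi0 : xi != 0%R) S : measurable S ->
  giry_map (measurable_first_step xi0) (P xi) S =
  giry_bind (giry_map (measurable_first_split cascade xi0) (P xi))
    (measurable_graph_law xi) S.
Proof.
apply: finite_measure_eq_rect3.
  by apply: (@le_lt_trans _ _ 1); [exact: sprobability_setT|exact: ltry].
move=> A C1 C2 mA mC1 mC2.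
transitivity (P xi [set omega |
    [/\ [set y : E * R * E | A (y.1.2, y.2)]
           (W xi [::] omega, tau xi [::] omega, W xi (child1 [::]) omega),
     C1 (subfamily W tau xi (child1 [::]) omega) &
     C2 (subfamily W tau xi (child2 [::]) omega)]]).
  by congr (P xi _); apply/seteqP; split => w /=; [case=> ? []|case].
rewrite (law_branch d_gt0 h_kernel cascade)//; last first.
  have mf : measurable_fun setT (fun y : E * R * E => (y.1.2, y.2) : Y).
    by apply: measurable_fun_pair => //; exact: measurableT_comp.
  by have := mf measurableT A mA; rewrite setTI.
have mS : measurable (A `*` (C1 `*` C2)) by do 2 apply: measurableX => //.
have mgS := measurable_giry_ev (R := R) mS.
transitivity (giry_int (giry_map (measurable_graph_law xi)
    (giry_map (measurable_first_split cascade xi0) (P xi))) (giry_ev ^~ (A `*` (C1 `*` C2)))).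
  rewrite giry_int_map// giry_int_map//; last first.
    exact: (measurableT_comp mgS (measurable_graph_law xi)).
  apply: eq_integral => w _.
  apply: etrans (esym (product_measure1E _ _ mA (measurableX mC1 mC2))).
  congr (_ * _); last exact/esym/product_measure1E.
by [].
Qed.

(** Disintegration along the first splitting: given it, the subtrees have the
    product law [branch_law], and it has density [split_density]. *)
Lemma ge0_integral_first_step xi (f : Y * (fam * fam) -> \bar R) : xi != 0%R ->
  measurable_fun setT f -> (forall p, 0 <= f p) ->
  \int[P xi]_omega f (first_step xi omega) =
  \int[lebesgue_time_space]_y
    ((\int[branch_law xi y]_z f (y, z)) * (split_density h xi y)%:E).
Proof.
move=> xi0 mf f0.
rewrite -(integral_first_split d_gt0 h_kernel cascade xi0
  (g := fun y => \int[branch_law xi y]_z f (y, z))); first last.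
- by move=> y; exact: integral_ge0.
- exact: measurable_integral_branch_law.
transitivity (giry_int (giry_map (measurable_first_step xi0) (P xi)) f).
  by rewrite giry_int_map.
transitivity (giry_int (giry_bind (giry_map (measurable_first_split cascade xi0) (P xi))
    (measurable_graph_law xi)) f).
  by apply: eq_measure_integral => S mS _; exact: law_first_step.
rewrite giry_int_bind// giry_int_map//.
- by apply: eq_integral => w _ /=; rewrite integral_graph_law.
- exact: (measurableT_comp (measurable_giry_int mf f0) (measurable_graph_law xi)).
- by move=> y; exact: integral_ge0.
Qed.

End first_step.

(** * Expectation of the solution process *)

Section cascade_process.
Context {R : realType} {d : nat}.
Hypothesis d_gt0 : (0 < d)%N.
Local Notation E := 'rV[R]_d.
Local Notation V := 'rV[R[i]]_d.
Local Notation fam := (@family R d).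
Local Notation Y := (measurableTypeR R * E)%type.
Variable h : E -> R.
Hypothesis h_kernel : standard_majorizing_kernel h.
Context {dO : measure_display} {Omega : measurableType dO}.
Variables (P : E -> probability Omega R).
Variables (W : E -> vertex -> Omega -> E) (tau : E -> vertex -> Omega -> R).
Hypothesis cascade : is_cascade h P W tau.
Local Open Scope ereal_scope.

Local Notation law := (family_law cascade).
Let mlaw := measurable_family_law d_gt0 h_kernel cascade.

(** Induction on the vertex: at the root the waiting time is exponential, and a
    vertex further down is a vertex of smaller length in one of the two
    subtrees, whose starting points are almost surely nonzero. *)
Lemma law_time_le0 v xi : xi != 0%R -> law xi [set p : fam | ((p v).2 <= 0)%R] = 0.
Proof.
have mN u : measurable [set p : fam | ((p u).2 <= 0)%R].
  rewrite -[X in measurable X]setTI.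
  have := measurable_fun_ler (measurableT_comp measurable_snd (measurable_at (R := R) (d := d) u))
    (measurable_cst (0 : R)%R).
  by move=> /(_ measurableT [set true] I); rewrite setTI.
elim: v xi => [|b v IH] xi xi0; rewrite family_lawE// /cascade_law.
  transitivity (P xi (first_split W tau xi @^-1` (`]-oo, 0%R] `*` setT))).
    by congr (P xi _); apply/seteqP; split => w /=; rewrite in_itv/=; [|case].
  rewrite (law_first_split d_gt0 h_kernel cascade)//; last exact: measurableX.
  rewrite split_law_rect// /exponential_prob.
  rewrite (ae_eq_integral_in _ (g := cst 0)) ?integral0 ?mul0e//.
  exists [set 0%R]; split; [exact: measurable_set1|exact: lebesgue_measure_set1|].
  move=> x /= /not_implyP[]; rewrite in_itv/= => x0 H; apply/eqP; apply: contra_notT H.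
  by move=> xN0; rewrite lt0_exponential_pdf// lt_neqAle xN0.
pose C c := if c == b then [set p : fam | ((p v).2 <= 0)%R] else setT.
have mC c : measurable (C c) by rewrite /C; case: ifP.
have := law_branch d_gt0 h_kernel cascade xi0 measurableT (mC false) (mC true).
rewrite (_ : [set _ | _] = [set omega | [set p : fam | ((p (b :: v)).2 <= 0)%R]
    (subfamily W tau xi [::] omega)]); last first.
  by rewrite /C; case: b {C mC IH} => /=; apply/seteqP; split => w /=; [case|..|case|].
move=> ->; rewrite (ae_eq_integralT (g := cst 0)) ?integral0//.
apply: filterS2 (ae_first_child_neq d_gt0 h_kernel cascade 0%R xi0)
  (ae_first_child_neq d_gt0 h_kernel cascade xi xi0) => w W0 Wxi.
rewrite /C; case: b {C mC} IH => IH /=.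
  by rewrite (IH (xi - _)%R) ?mule0// subr_eq0 eq_sym.
by rewrite IH// mul0e mule0.
Qed.

Lemma ae_time_gt0 xi : xi != 0%R ->
  {ae P xi, forall omega, forall v, (0 < tau xi v omega)%R}.
Proof.
move=> xi0.
have H v : {ae P xi, forall omega, (0 < tau xi v omega)%R}.
  exists [set omega | (tau xi v omega <= 0)%R]; split.
  - have := measurable_fun_ler (cascade_measurableT cascade v xi0)
      (measurable_cst (0 : R)%R).
    by move=> /(_ measurableT [set true] I); rewrite setTI.
  - by have := law_time_le0 v xi0; rewrite family_lawE.
  - by move=> w /= /negP; rewrite -leNgt.
have := ae_foralln (mu := P xi) (P := fun n omega => if unpickle n is Some v
  then (0 < tau xi v omega)%R else True).
case=> [n|N [mN N0 sN]].
  by case: (unpickle n) => [v|]; [exact: H|exact: aeW].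
exists N; split => // w Hw; apply: sN => Hn; apply: Hw => v.
by have /= [vE] := pickleK v; have /= := Hn (pickle v); rewrite vE.
Qed.

Variable chi0 : E -> V.
Hypothesis mchi0 : cvmeasurable chi0.
Local Notation X := (canonical_process chi0).

(** Contribution of the event that the root branches before time [t]. *)
Definition branched (xi : E) (t : R) (q : Y * (fam * fam)) : V :=
  if (q.1.1 < t)%R then odot xi (X (t - q.1.1)%R q.2.1) (X (t - q.1.1)%R q.2.2)
  else 0%R.

Lemma measurable_branched xi t : cvmeasurable (branched xi t).
Proof.
have m1 : measurable_fun setT (fun q : Y * (fam * fam) => (t - q.1.1)%R).
  apply: measurable_funB => //.
  exact: (measurableT_comp (@measurable_fst _ _ (measurableTypeR R) E) measurable_fst).
have mb (g : fam * fam -> fam) : measurable_fun setT g ->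
    cvmeasurable (fun q : Y * (fam * fam) => X (t - q.1.1)%R (g q.2)).
  move=> mg; apply: (cvmeasurable_comp (measurable_canonical_process mchi0)
    (g := fun q : Y * (fam * fam) => ((t - q.1.1)%R, g q.2))).
  by apply: measurable_fun_pair => //; exact: measurableT_comp.
apply: cvmeasurable_if.
- apply: measurable_fun_ltr => //.
  exact: (measurableT_comp (@measurable_fst _ _ (measurableTypeR R) E) measurable_fst).
- by apply: cvmeasurable_odot; [exact: measurable_cst|exact: mb..].
- exact: cvmeasurable_cst.
Qed.

Lemma ae_process_first_step xi t : xi != 0%R ->
  {ae P xi, forall omega, solution_process W tau chi0 xi t omega =
    ((if (t <= tau xi [::] omega)%R then chi0 xi else 0) +
     branched xi t (first_step W tau xi omega))%R}.
Proof.
move=> xi0; apply: filterS2 (ae_time_gt0 xi0) (cascade_root cascade xi0) => w T0 W0.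
rewrite solution_processE /branched/=.
case: leP => tT.
  by rewrite canonical_process_stop ?addr0//= ?W0.
by rewrite canonical_process_branch// add0r !subtree_subfamily/= W0.
Qed.

(** The expectation of the solution process, computed on the space of
    realizations. Unlike [solution_mean], which is uncontrolled at [xi = 0], it is
    measurable in [(xi, t)] without restriction; both agree for [xi != 0]. *)
Definition law_mean xi t : V := cvintegral (law xi) setT (X t).

Lemma measurable_law_integral (f : R * fam -> \bar R) :
  measurable_fun setT f -> (forall p, 0 <= f p) ->
  measurable_fun setT (fun q : E * R => \int[law q.1]_p f (q.2, p)).
Proof.
move=> mf f0.
rewrite (_ : (fun _ => _) = (fun q : E * R =>
    giry_int (giry_prod (giry_ret (R := R) q.2, law q.1)) f)); last first.
  apply/funext => q; rewrite giry_int_prod1// giry_int_ret//.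
  exact: (@measurable_fun_fubini_tonelli_F _ _ _ _ _ (law q.1) f).
apply: (measurableT_comp (measurable_giry_int mf f0)).
apply: (measurableT_comp measurable_giry_prod); apply: measurable_fun_pair.
  by apply: measurableT_comp; [exact: measurable_giry_ret|].
exact: (measurableT_comp mlaw).
Qed.

Lemma measurable_law_mean : cvmeasurable (fun q : E * R => law_mean q.1 q.2).
Proof.
move=> k; rewrite (_ : (fun _ => _) = (fun q : E * R =>
    fine (\int[law q.1]_p (rcoord k (X q.2 p))%:E))); last first.
  by apply/funext => q; rewrite rcoord_cvintegral.
apply: measurableT_comp; first exact: fine_measurable.
pose F (p : R * fam) : \bar R := (rcoord k (X p.1 p.2))%:E.
have mF : measurable_fun setT F.
  by apply/measurable_EFinP; exact: measurable_canonical_process.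
rewrite (_ : (fun _ => _) = (fun q : E * R =>
    \int[law q.1]_p F^\+ (q.2, p) - \int[law q.1]_p F^\- (q.2, p))).
  apply: emeasurable_funB; apply: measurable_law_integral => //.
    exact: measurable_funepos.
  exact: measurable_funeneg.
apply/funext => q; rewrite integralE; congr (_ - _); apply: eq_integral => p _.
  by rewrite !funeposE.
by rewrite !funenegE.
Qed.

Lemma measurable_process xi t : xi != 0%R ->
  cvmeasurable (solution_process W tau chi0 xi t).
Proof.
move=> xi0; rewrite (_ : solution_process _ _ _ _ _ =
    (fun omega => X t (subfamily W tau xi [::] omega))).
  apply: (cvmeasurable_comp (measurable_canonical_process mchi0)
    (g := fun omega => (t, subfamily W tau xi [::] omega : fam))).
  by apply: measurable_fun_pair => //; exact: (measurable_subfamily cascade).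
by apply/funext => w; exact: solution_processE.
Qed.

Lemma measurable_canonical_at t : cvmeasurable (X t).
Proof.
apply: (cvmeasurable_comp (measurable_canonical_process mchi0) (g := fun p => (t, p))).
exact: measurable_fun_pair.
Qed.

Lemma integral_law xi (g : fam -> \bar R) : xi != 0%R -> measurable_fun setT g ->
  \int[law xi]_p g p = \int[P xi]_omega g (subfamily W tau xi [::] omega).
Proof.
move=> xi0 mg; apply: (integral_pushforwardT (mu := P xi) (nu := law xi)) => //.
  exact: (measurable_subfamily cascade).
by move=> A mA; exact: family_lawE.
Qed.

Lemma solution_meanE xi t : xi != 0%R ->
  solution_mean P W tau chi0 xi t = law_mean xi t.
Proof.
move=> xi0; apply: rcoord_eq => k; rewrite !rcoord_cvintegral integral_law//.
  by congr fine; apply: eq_integral => w _; rewrite solution_processE.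
by apply/measurable_EFinP; exact: measurable_canonical_at.
Qed.

End cascade_process.

(** * The bilinear term at almost every splitting *)

Section mild_formulation.
Context {R : realType} {d : nat}.
Hypothesis d_gt0 : (0 < d)%N.
Local Notation E := 'rV[R]_d.
Local Notation V := 'rV[R[i]]_d.
Local Notation fam := (@family R d).
Local Notation Y := (measurableTypeR R * E)%type.
Variable h : E -> R.
Hypothesis h_kernel : standard_majorizing_kernel h.
Context {dO : measure_display} {Omega : measurableType dO}.
Variables (P : E -> probability Omega R).
Variables (W : E -> vertex -> Omega -> E) (tau : E -> vertex -> Omega -> R).
Hypothesis cascade : is_cascade h P W tau.
Variable chi0 : E -> V.
Hypothesis mchi0 : cvmeasurable chi0.
Variables (T : \bar R) (Q : set (E * R)).
Hypothesis Q_sub : Q `<=` [set q | 0 <= q.2 /\ (q.2%:E < T)%E].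
Hypothesis Q_full : (lebesgue_rV d \x lebesgue_measure)%E.-negligible
  ([set q | 0 <= q.2 /\ (q.2%:E < T)%E] `\` Q).
Hypothesis Q_neq0 : forall xi t, Q (xi, t) -> xi != 0.
Hypothesis X_finite : forall xi t, Q (xi, t) ->
  (\int[P xi]_omega (cnorm (solution_process W tau chi0 xi t omega))%:E < +oo)%E.
Local Open Scope ereal_scope.

Local Notation law := (family_law cascade).
Local Notation X := (canonical_process chi0).
Local Notation mean := (law_mean cascade chi0).
Local Notation lts := (@lebesgue_time_space R d).

Lemma integrable_canonical xi t : Q (xi, t) -> cvintegrable (law xi) setT (X t).
Proof.
move=> Qxt; have xi0 := Q_neq0 Qxt; apply: cnorm_integrable.
  exact: measurable_canonical_at.
rewrite integral_law//; last first.
  by apply/measurable_EFinP; apply: cvmeasurable_cnorm; exact: measurable_canonical_at.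
under eq_integral do rewrite -(solution_processE chi0).
exact: X_finite.
Qed.

Lemma lebesgue_swap (N : set (E * R)) : measurable N ->
  lts [set y | N (y.2, y.1)] = (lebesgue_rV d \x lebesgue_measure)%E N.
Proof.
move=> mN.
have mswap : measurable_fun setT (fun y : Y => (y.2, y.1) : E * measurableTypeR R).
  exact: measurable_fun_pair.
have mN' : measurable [set y : Y | N (y.2, y.1)].
  by have := mswap measurableT N mN; rewrite setTI.
pose F (p : E * measurableTypeR R) : \bar R := (\1_N p)%:E.
have mF : measurable_fun setT F by apply/measurable_EFinP; exact: measurable_indic.
have F0 p : 0 <= F p by rewrite lee_fin.
transitivity (\int[lts]_y F (y.2, y.1)).
  transitivity (\int[lts]_y (\1_[set y : Y | N (y.2, y.1)] y)%:E).
    by rewrite integral_indic// setIT.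
  by apply: eq_integral => y _; rewrite /F !indicE; congr ((nat_of_bool _)%:R%:E).
transitivity (\int[(lebesgue_rV d \x lebesgue_measure)]_p F p); last first.
  by rewrite integral_indic// setIT.
rewrite (fubini_tonelli1 (m1 := lebesgue_rV d) (m2 := lebesgue_measure))//.
rewrite (fubini_tonelli1 (m1 := lebesgue_measure) (m2 := lebesgue_rV d)
  (fun y : Y => F (y.2, y.1)))//; last exact: (measurableT_comp mF).
exact/esym/(fubini_tonelli (m1 := lebesgue_rV d) (m2 := lebesgue_measure) F).
Qed.

(** Almost every point of the time strip lies in [Q]; by Fubini's theorem and
    invariance of Lebesgue measure under reflections in time and space, for almost
    every splitting before time [t] both children, taken at the remaining time,
    are points of [Q]. *)
Lemma ae_good xi t : Q (xi, t) ->
  {ae lts, forall y : Y, y.1 != t /\ ((0 <= y.1 < t)%R ->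
    Q (y.2, (t - y.1)%R) /\ Q ((xi - y.2)%R, (t - y.1)%R))}.
Proof.
move=> Qxt; have /= [t0 tT] := Q_sub Qxt.
have [N [mN N0 sN]] := Q_full.
pose N' : set Y := [set y | N (y.2, y.1)].
have mN' : measurable N'.
  have mswap : measurable_fun setT (fun y : Y => (y.2, y.1) : E * measurableTypeR R).
    exact: measurable_fun_pair.
  by have := mswap measurableT N mN; rewrite setTI.
have N'0 : lts N' = 0 by rewrite lebesgue_swap.
pose B1 := (fun y : Y => ((t - y.1)%R, y.2) : Y) @^-1` N'.
pose B2 := (fun y : Y => ((t - y.1)%R, (xi - y.2)%R) : Y) @^-1` N'.
pose B3 : set Y := [set t] `*` setT.
have mrefl : measurable_fun setT (fun s : measurableTypeR R => (t - s)%R : measurableTypeR R).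
  exact: measurable_funB.
have msub : measurable_fun setT (fun eta : E => (xi - eta)%R) by exact: measurable_rowvecB.
have mB1 : measurable B1.
  rewrite -[X in measurable X]setTI; apply: (_ : measurable_fun setT _) => //.
  by apply: measurable_fun_pair => //; exact: (measurableT_comp mrefl).
have mB2 : measurable B2.
  rewrite -[X in measurable X]setTI; apply: (_ : measurable_fun setT _) => //.
  by apply: measurable_fun_pair; [exact: (measurableT_comp mrefl)|exact: (measurableT_comp msub)].
have mB3 : measurable B3 by exact: measurableX.
have B10 : lts B1 = 0.
  rewrite -N'0; apply: (product_measure_preserving (m1 := lebesgue_measure)
    (m2 := lebesgue_rV d) (f1 := fun s : R => (t - s)%R) (f2 := id)) => //.
  exact: lebesgue_reflect.
have B20 : lts B2 = 0.
  rewrite -N'0; apply: (product_measure_preserving (m1 := lebesgue_measure)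
    (m2 := lebesgue_rV d) (f1 := fun s : R => (t - s)%R)
    (f2 := fun eta : E => (xi - eta)%R)) => //.
    exact: lebesgue_reflect.
  exact: lebesgue_rV_reflect.
have B30 : lts B3 = 0.
  apply: etrans (product_measure1E _ _ _ measurableT) _ => //.
  by apply: etrans (mul0e _); congr (_ * _); exact: lebesgue_measure_set1.
exists (B1 `|` B2 `|` B3); split.
- exact: (measurableU _ _ (measurableU _ _ mB1 mB2) mB3).
- exact: (null_set_setU (measurableU _ _ mB1 mB2) mB3
    (null_set_setU mB1 mB2 B10 B20) B30).
- move=> y /= H; apply: contrapT => /not_orP[/not_orP[nB1 nB2] nB3]; apply: H.
  split; first by apply/eqP => yt; apply: nB3.
  move=> /andP[s0 st]; have inT (eta : E) : [set q : E * R | (0 <= q.2)%R /\ q.2%:E < T] (eta, (t - y.1)%R).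
    split => /=; first by rewrite subr_ge0 ltW.
    by apply: le_lt_trans tT; rewrite lee_fin gerBl.
  split; apply: contrapT => nQ; [apply: nB1|apply: nB2]; apply: sN.
    by split => //; exact: inT.
  by split => //; exact: inT.
Qed.

(** Value of the bilinear term of the equation when the root branches at time
    [y.1] with first child [y.2]. *)
Definition mean_odot xi t (y : Y) : V :=
  if (0 <= y.1 <= t)%R then odot xi (mean y.2 (t - y.1)%R) (mean (xi - y.2)%R (t - y.1)%R)
  else 0%R.

Lemma measurable_mean_odot xi t : cvmeasurable (mean_odot xi t).
Proof.
have ms : measurable_fun setT (fun y : Y => y.1 : R) by exact: measurable_fst.
have mts : measurable_fun setT (fun y : Y => (t - y.1)%R) by exact: measurable_funB.
have mm (g : Y -> E) : measurable_fun setT g ->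
    cvmeasurable (fun y : Y => mean (g y) (t - y.1)%R).
  move=> mg; apply: (cvmeasurable_comp (measurable_law_mean d_gt0 h_kernel cascade mchi0)
    (g := fun y : Y => (g y, (t - y.1)%R))).
  exact: measurable_fun_pair.
apply: cvmeasurable_if; last exact: cvmeasurable_cst.
- by apply: measurable_and; apply: measurable_fun_ler.
- apply: cvmeasurable_odot; first exact: measurable_cst.
    by apply: mm; exact: measurable_snd.
  by apply: mm; apply: measurable_rowvecB => //; exact: measurable_snd.
Qed.

Local Notation branched := (branched chi0).
Local Notation blaw := (branch_law cascade).
Local Notation dens := (split_density h).

Let abs_branched xi t (y : Y) := \int[blaw xi y]_z (cnorm (branched xi t (y, z)))%:E.

(** The left-hand side is the expectation of the norm of the solution process
    over the event that the root branches before time [t]. *)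
Lemma integral_abs_branched xi t : Q (xi, t) ->
  \int[lts]_y (abs_branched xi t y * (dens xi y)%:E) < +oo.
Proof.
move=> Qxt; have xi0 := Q_neq0 Qxt.
have mF : measurable_fun setT (fun q => (cnorm (branched xi t q))%:E).
  by apply/measurable_EFinP/cvmeasurable_cnorm; exact: measurable_branched.
rewrite -(ge0_integral_first_step d_gt0 h_kernel cascade xi0 mF)//; last first.
  by move=> p; rewrite lee_fin cnorm_ge0.
apply: le_lt_trans (X_finite Qxt); apply: ae_ge0_le_integral => //.
- by move=> w _; rewrite lee_fin cnorm_ge0.
- exact: (measurableT_comp mF (measurable_first_step cascade xi0)).
- by move=> w _; rewrite lee_fin cnorm_ge0.
- by apply/measurable_EFinP/cvmeasurable_cnorm; exact: (measurable_process cascade).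
apply: filterS (ae_process_first_step d_gt0 h_kernel cascade chi0 t xi0) => w -> _.
rewrite lee_fin /branched/=; case: ltP => tT; last by rewrite cnorm0 cnorm_ge0.
by rewrite add0r.
Qed.

(** The two subtrees are independent given the splitting, and both expectations
    exist at a splitting that leads to points of [Q]. *)
Lemma good_branch xi t (y : Y) k : (0 <= y.1 < t)%R ->
  Q (y.2, (t - y.1)%R) -> Q ((xi - y.2)%R, (t - y.1)%R) ->
  (blaw xi y).-integrable setT (fun z => (rcoord k (branched xi t (y, z)))%:E) /\
  \int[blaw xi y]_z (rcoord k (branched xi t (y, z)))%:E =
    (rcoord k (mean_odot xi t y))%:E.
Proof.
move=> /andP[s0 st] Q1 Q2.
rewrite /mean_odot s0 (ltW st)/=.
have := integral_odot xi (measurable_canonical_at mchi0 (t - y.1))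
  (measurable_canonical_at mchi0 (t - y.1)) (integrable_canonical Q1) (integrable_canonical Q2) k.
by rewrite /branched/= st.
Qed.

(** Jensen's inequality coordinate by coordinate, at the price of a factor 2d. *)
Lemma good_cnorm_le xi t (y : Y) : (0 <= y.1 < t)%R ->
  Q (y.2, (t - y.1)%R) -> Q ((xi - y.2)%R, (t - y.1)%R) ->
  (cnorm (mean_odot xi t y))%:E <=
    #|{: 'I_d * bool}|%:R%:E * abs_branched xi t y.
Proof.
move=> st Q1 Q2.
apply: (@le_trans _ _ (\sum_k `|rcoord k (mean_odot xi t y)|%:E)).
  by rewrite sumEFin lee_fin cnorm_le_sum.
apply: (@le_trans _ _ (\sum_(k : 'I_d * bool) abs_branched xi t y)); last first.
  rewrite sumr_const mule_natl.
  by elim: #|_| => [|n IHn]; [rewrite mulr0n mule0n|rewrite mulrS muleS leeD2l].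
apply: lee_sum => k _; have [ik qE] := good_branch k st Q1 Q2.
apply: (@le_trans _ _ `|\int[blaw xi y]_z (rcoord k (branched xi t (y, z)))%:E|).
  by rewrite qE.
apply: le_trans (le_abse_integral _ measurableT (measurable_int _ ik)) _.
have mF k' : measurable_fun setT (fun z => (rcoord k' (branched xi t (y, z)))%:E).
  apply/measurable_EFinP.
  exact: (measurable_fun_pair2 y (measurable_branched mchi0 xi t k')).
apply: ge0_le_integral => //.
- exact: measurableT_comp.
- apply/measurable_EFinP.
  exact: (measurable_fun_pair2 y (cvmeasurable_cnorm (measurable_branched mchi0 xi t))).
- by move=> z _; rewrite lee_fin rcoord_le_cnorm.
Qed.



Let split_density_lt0 xi (y : Y) : (y.1 < 0)%R -> dens xi y = 0%R.
Proof. by move=> y0; rewrite /split_density lt0_exponential_pdf// mul0r. Qed.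

Let measurable_dens xi : measurable_fun setT (fun y : Y => (dens xi y)%:E).
Proof. by apply/measurable_EFinP; exact: (measurable_split_density1 h_kernel). Qed.

Let dens_ge0 xi (y : Y) : (0 <= dens xi y)%R.
Proof. exact: split_density_ge0. Qed.

Let measurable_branch_integral xi t (F : V -> \bar R) :
  measurable_fun setT (fun q => F (branched xi t q)) -> (forall a, 0 <= F a) ->
  measurable_fun setT (fun y : Y => \int[blaw xi y]_z F (branched xi t (y, z))).
Proof.
move=> mF F0.
by have := measurable_integral_branch_law d_gt0 h_kernel cascade xi mF; apply.
Qed.

Let measurable_abs_branched xi t : measurable_fun setT (abs_branched xi t).
Proof.
apply: (measurable_branch_integral (F := fun a => (cnorm a)%:E)) => [|a].
  by apply/measurable_EFinP/cvmeasurable_cnorm; exact: measurable_branched.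
by rewrite lee_fin cnorm_ge0.
Qed.

Let abs_branched_ge0 xi t y : 0 <= abs_branched xi t y.
Proof. by apply: integral_ge0 => z _; rewrite lee_fin cnorm_ge0. Qed.

Lemma integral_cnorm_mean_odot xi t : Q (xi, t) ->
  \int[lts]_y (cnorm (mean_odot xi t y) * dens xi y)%:E < +oo.
Proof.
move=> Qxt; set K : R := #|{: 'I_d * bool}|%:R.
apply: (@le_lt_trans _ _ (\int[lts]_y (K%:E * (abs_branched xi t y * (dens xi y)%:E)))).
  apply: ae_ge0_le_integral => //.
  - by move=> y _; rewrite lee_fin mulr_ge0 ?cnorm_ge0.
  - apply/measurable_EFinP; apply: measurable_funM.
      by apply: cvmeasurable_cnorm; exact: measurable_mean_odot.
    exact: (measurable_split_density1 h_kernel).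
  - by move=> y _; rewrite !mule_ge0 ?lee_fin ?ler0n.
  - by apply: measurable_funeM; apply: emeasurable_funM.
  apply: filterS (ae_good Qxt) => y [yt good] _.
  have [y0|y0] := ltP y.1 0%R; first by rewrite split_density_lt0// mulr0 !mule0.
  rewrite muleA EFinM; apply: lee_wpmul2r; first by rewrite lee_fin.
  have [ylt|tly] := ltP y.1 t.
    by have [|Q1 Q2] := good; [rewrite y0|apply: good_cnorm_le => //; rewrite y0].
  have ty : (y.1 <= t)%R = false by rewrite leNgt lt_neqAle eq_sym yt tly.
  rewrite /mean_odot y0 ty/= cnorm0.
  by rewrite mule_ge0// lee_fin ler0n.
rewrite ge0_integralZl//.
- by rewrite lte_mul_pinfty ?lee_fin ?ler0n//; exact: integral_abs_branched.
- exact: emeasurable_funM.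
- by move=> y _; rewrite mule_ge0// lee_fin.
- by rewrite lee_fin ler0n.
Qed.

Lemma integrable_mean_odot xi t k : Q (xi, t) ->
  lts.-integrable setT (fun y => (rcoord k (mean_odot xi t y) * dens xi y)%:E).
Proof.
move=> Qxt; apply/integrableP; split.
  apply/measurable_EFinP; apply: measurable_funM; first exact: measurable_mean_odot.
  exact: (measurable_split_density1 h_kernel).
apply: le_lt_trans (integral_cnorm_mean_odot Qxt); apply: ge0_le_integral => //.
- apply: measurableT_comp => //; apply/measurable_EFinP; apply: measurable_funM.
    exact: measurable_mean_odot.
  exact: (measurable_split_density1 h_kernel).
- apply/measurable_EFinP; apply: measurable_funM.
    by apply: cvmeasurable_cnorm; exact: measurable_mean_odot.
  exact: (measurable_split_density1 h_kernel).
- move=> y _; rewrite lee_fin normrM (ger0_norm (dens_ge0 xi y)) ler_wpM2r//.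
  exact: rcoord_le_cnorm.
Qed.

Lemma integrable_process xi t : Q (xi, t) ->
  cvintegrable (P xi) setT (solution_process W tau chi0 xi t).
Proof.
move=> Qxt; apply: cnorm_integrable; last exact: X_finite.
by apply: (measurable_process cascade) => //; exact: Q_neq0 Qxt.
Qed.

(** The first-step formula holds for nonnegative integrands; it is applied to the
    positive and negative parts, whose inner expectations are finite at almost
    every splitting, and there their difference is a product of expectations. *)
Lemma integral_branched xi t k : Q (xi, t) ->
  \int[P xi]_omega (rcoord k (branched xi t (first_step W tau xi omega)))%:E =
  \int[lts]_y (rcoord k (mean_odot xi t y) * dens xi y)%:E.
Proof.
move=> Qxt; have xi0 := Q_neq0 Qxt.
pose F q : \bar R := (rcoord k (branched xi t q))%:E.
have mF : measurable_fun setT F by apply/measurable_EFinP; exact: measurable_branched.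
have cnormF q : `|F q| <= (cnorm (branched xi t q))%:E.
  by rewrite lee_fin rcoord_le_cnorm.
have half (G : Y * (fam * fam) -> \bar R) : measurable_fun setT G ->
    (forall q, 0 <= G q) -> (forall q, G q <= `|F q|) ->
  lts.-integrable setT (fun y => (\int[blaw xi y]_z G (y, z)) * (dens xi y)%:E).
  move=> mG G0 GF; apply/integrableP; split.
    by apply: emeasurable_funM => //; exact: measurable_integral_branch_law.
  apply: le_lt_trans (integral_abs_branched Qxt); apply: ge0_le_integral => //.
  - apply: measurableT_comp => //; apply: emeasurable_funM => //.
    exact: measurable_integral_branch_law.
  - exact: emeasurable_funM.
  - move=> y _; rewrite gee0_abs; last by rewrite mule_ge0 ?integral_ge0 ?lee_fin.
    apply: lee_wpmul2r; first by rewrite lee_fin.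
    apply: ge0_le_integral => //.
    + exact: (measurable_fun_pair2 y mG).
    + apply/measurable_EFinP.
      exact: (measurable_fun_pair2 y (cvmeasurable_cnorm (measurable_branched mchi0 xi t))).
    + by move=> z _; apply: le_trans (GF _) (cnormF _).
have mFp := measurable_funepos mF; have mFn := measurable_funeneg mF.
have FpF q : F^\+ q <= `|F q| by rewrite -/((abse \o F) q) fune_abse/= leeDl.
have FnF q : F^\- q <= `|F q| by rewrite -/((abse \o F) q) fune_abse/= leeDr.
transitivity (\int[P xi]_omega F^\+ (first_step W tau xi omega) -
    \int[P xi]_omega F^\- (first_step W tau xi omega)).
  rewrite integralE; congr (_ - _); apply: eq_integral => w _.
    by rewrite !funeposE.
  by rewrite !funenegE.
rewrite !(ge0_integral_first_step d_gt0 h_kernel cascade)//.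
rewrite -integralB//; [|exact: half..].
apply: ae_eq_integralT; apply: filterS (ae_good Qxt) => y [yt good].
have [y0|y0] := ltP y.1 0%R; first by rewrite split_density_lt0// mulr0 !mule0 sube0.
have [ylt|tly] := ltP y.1 t; last first.
  have b0 z : F (y, z) = 0.
    by rewrite /F /branched/= ltNge tly/= /rcoord; case: ifP => _; rewrite mxE.
  have ty : (y.1 <= t)%R = false by rewrite leNgt lt_neqAle eq_sym yt tly.
  rewrite /mean_odot y0 ty/=.
  have -> : \int[blaw xi y]_z F^\+ (y, z) = 0.
    by apply: integral0_eq => z _; rewrite funeposE b0 maxxx.
  have -> : \int[blaw xi y]_z F^\- (y, z) = 0.
    by apply: integral0_eq => z _; rewrite funenegE b0 oppe0 maxxx.
  by rewrite mul0e sube0 /rcoord; case: ifP => _; rewrite mxE mul0r.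
have [|Q1 Q2] := good; first by rewrite y0.
have st : (0 <= y.1 < t)%R by rewrite y0.
have [ik qE] := good_branch k st Q1 Q2.
have ip := integrable_fin_num measurableT (integrable_funepos measurableT ik).
have iN := integrable_fin_num measurableT (integrable_funeneg measurableT ik).
have Ep : \int[blaw xi y]_z F^\+ (y, z) = \int[blaw xi y]_z (fun z => (rcoord k (branched xi t (y, z)))%:E)^\+ z.
  by apply: eq_integral => z _; rewrite !funeposE.
have En : \int[blaw xi y]_z F^\- (y, z) = \int[blaw xi y]_z (fun z => (rcoord k (branched xi t (y, z)))%:E)^\- z.
  by apply: eq_integral => z _; rewrite !funenegE.
rewrite integralE in qE.
rewrite Ep En (EFinM (rcoord k _)) -qE -(fineK ip) -(fineK iN).
have muleBl_fin (a b c : R) : a%:E * c%:E - b%:E * c%:E = (a%:E - b%:E) * c%:E.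
  exact: (congr1 EFin (esym (mulrBl c a b))).
exact: muleBl_fin.
Qed.

End mild_formulation.

(** * The integral equation *)

Section final.
Context {R : realType} {d : nat}.
Hypothesis d_gt0 : (0 < d)%N.
Local Notation E := 'rV[R]_d.
Local Notation V := 'rV[R[i]]_d.
Local Notation fam := (@family R d).
Local Notation Y := (measurableTypeR R * E)%type.
Variable h : E -> R.
Hypothesis h_kernel : standard_majorizing_kernel h.
Context {dO : measure_display} {Omega : measurableType dO}.
Variables (P : E -> probability Omega R).
Variables (W : E -> vertex -> Omega -> E) (tau : E -> vertex -> Omega -> R).
Hypothesis cascade : is_cascade h P W tau.
Variable chi0 : E -> V.
Hypothesis mchi0 : cvmeasurable chi0.
Variables (T : \bar R) (Q : set (E * R)).
Hypothesis Q_sub : Q `<=` [set q | 0 <= q.2 /\ (q.2%:E < T)%E].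
Hypothesis Q_full : (lebesgue_rV d \x lebesgue_measure)%E.-negligible
  ([set q | 0 <= q.2 /\ (q.2%:E < T)%E] `\` Q).
Hypothesis Q_neq0 : forall xi t, Q (xi, t) -> xi != 0.
Hypothesis X_finite : forall xi t, Q (xi, t) ->
  (\int[P xi]_omega (cnorm (solution_process W tau chi0 xi t omega))%:E < +oo)%E.
Local Open Scope ereal_scope.

Local Notation law := (family_law cascade).
Local Notation X := (canonical_process chi0).
Local Notation mean := (law_mean cascade chi0).
Local Notation lts := (@lebesgue_time_space R d).
Local Notation mean_odot := (mean_odot cascade chi0).
Local Notation dens := (split_density h).
Local Notation chi := (solution_mean P W tau chi0).
Local Notation branched := (branched chi0).

(** Complement of the bounded interval whose probability is known. *)
Lemma exponential_prob_ge (a t : R) : (0 < a)%R -> (0 <= t)%R ->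
  exponential_prob a `[t, +oo[ = (expR (- a * t))%:E.
Proof.
move=> a0 t0.
have pdf0 x : 0 <= (exponential_pdf a x)%:E by rewrite lee_fin exponential_pdf_ge0// ltW.
have mpdf : measurable_fun setT (fun x : measurableTypeR R => (exponential_pdf a x)%:E).
  by apply/measurable_EFinP; exact: measurable_exponential_pdf.
have head : \int[@lebesgue_measure R]_(x in `]-oo, t[) (exponential_pdf a x)%:E =
    1 - (expR (- a * t))%:E.
  have -> : 1 - (expR (- a * t))%:E = exponential_prob a `[0%R, t].
    have [->|tn0] := eqVneq t 0%R.
      by rewrite mulr0 expR0 subee// /exponential_prob set_itv1 integral_set1.
    by rewrite exponential_prob_itv0c// lt_neqAle eq_sym tn0.
  rewrite /exponential_prob integral_mkcond [RHS]integral_mkcond.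
  apply: (integral_eq_off_null (N := [set t] : set (measurableTypeR R))) => //.
    exact: lebesgue_measure_set1.
  move=> x xt; rewrite !patchE !mem_setE !in_itv/=.
  have [x0|x0] := ltP x 0%R.
    by rewrite lt0_exponential_pdf// if_same.
  by rewrite lt_neqAle; have -> : x != t by exact/eqP.
have mL : measurable (`]-oo, t[%classic : set (measurableTypeR R)) by [].
have mU : measurable (`[t, +oo[%classic : set (measurableTypeR R)) by [].
have UT : `]-oo, t[%classic `|` `[t, +oo[%classic = setT :> set R.
  by apply/seteqP; split => // x _ /=; rewrite !in_itv/= andbT; case: ltP; [left|right].
have := integral_exponential_pdf a0.
rewrite -UT (ge0_integral_setU lebesgue_measure mL mU)//; last 2 first.
- exact: measurable_funTS.
- by rewrite disj_set2E; apply/eqP/seteqP; split => x //=; rewrite !in_itv/= => -[? ?]; lra.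
rewrite head -[X in _ + X](_ : exponential_prob a `[t, +oo[ = _)//.
case: (exponential_prob _ _) => [r| |]//; rewrite -EFinB -EFinD => -[H].
by congr EFin; lra.
Qed.

Lemma waiting_time_law xi t : xi != 0%R -> (0 <= t)%R ->
  P xi [set omega | (t <= tau xi [::] omega)%R] =
  (expR (- t * enorm xi ^+ 2))%:E.
Proof.
move=> xi0 t0.
have a0 : (0 < enorm xi ^+ 2)%R by rewrite exprn_gt0 ?enorm_gt0.
have I1 : \int[lebesgue_rV d]_(eta in setT) (branching_density h eta xi)%:E = 1.
  have := law_first_split d_gt0 h_kernel cascade xi0 measurableT.
  rewrite preimage_setT -setXTT split_law_rect//.
  rewrite [X in X * _](_ : _ = 1); last exact: integral_exponential_pdf.
  by rewrite mul1e => <-; exact: probability_setT.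
have := law_first_split d_gt0 h_kernel cascade xi0
  (measurableX (measurable_itv `[t, +oo[) measurableT).
rewrite split_law_rect// I1 mule1 exponential_prob_ge// mulNr mulrC -mulNr => <-.
congr (P xi _); apply/seteqP; split => w /=; rewrite in_itv/= andbT; [|case].
  by [].
by [].
Qed.

(** Either the root waits until time [t], with probability
    [exp (- t |xi|^2)], and the process is the initial datum, or it branches
    before. *)
Lemma solution_mean_split xi t k : Q (xi, t) ->
  rcoord k (chi xi t) = (expR (- t * enorm xi ^+ 2) * rcoord k (chi0 xi) +
    fine (\int[lts]_y (rcoord k (mean_odot xi t y) * dens xi y)%:E))%R.
Proof.
move=> Qxt; have xi0 := Q_neq0 Qxt; have [/= t0 _] := Q_sub Qxt.
rewrite rcoord_cvintegral.
pose A := [set omega | (t <= tau xi [::] omega)%R].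
have mA : measurable A.
  have := measurable_fun_ler (measurable_cst t) (cascade_measurableT cascade [::] xi0).
  by move=> /(_ measurableT [set true] I); rewrite setTI.
pose b omega := branched xi t (first_step W tau xi omega).
have mb : measurable_fun setT (fun omega => rcoord k (b omega)).
  exact: (measurableT_comp (measurable_branched mchi0 xi t k) (measurable_first_step cascade xi0)).
have ib : (P xi).-integrable setT (fun omega => (rcoord k (b omega))%:E).
  apply/integrableP; split; first exact/measurable_EFinP.
  have mc : measurable_fun setT (fun q => (cnorm (branched xi t q))%:E).
    by apply/measurable_EFinP/cvmeasurable_cnorm; exact: measurable_branched.
  have := integral_abs_branched d_gt0 h_kernel cascade mchi0 Q_neq0 X_finite Qxt.
  rewrite -(ge0_integral_first_step d_gt0 h_kernel cascade xi0 mc)//; last first.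
    by move=> p; rewrite lee_fin cnorm_ge0.
  move=> H; apply: le_lt_trans H; apply: ge0_le_integral => //.
  - by apply: measurableT_comp => //; exact/measurable_EFinP.
  - exact: (measurableT_comp mc (measurable_first_step cascade xi0)).
  - by move=> w _; rewrite lee_fin rcoord_le_cnorm.
transitivity (fine (\int[P xi]_omega ((rcoord k (chi0 xi))%:E * (\1_A omega)%:E +
    (rcoord k (b omega))%:E))).
  congr fine; apply: ae_eq_integralT.
  apply: filterS (ae_process_first_step d_gt0 h_kernel cascade chi0 t xi0) => w ->.
  have [rD rZ] := real_linear_rcoord (R := R) k.
  rewrite rD EFinD; congr (_ + _); rewrite indicE /A -EFinM; congr EFin.
  have [tT|Tt] := leP t (tau xi [::] w); first by rewrite mem_set// mulr1.
  rewrite memNset ?mulr0//=; last by apply/negP; rewrite -ltNge.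
  by rewrite /rcoord; case: ifP => _; rewrite mxE.
have iA : (P xi).-integrable setT (fun omega => (\1_A omega)%:E).
  by apply: integrable_indic => //; exact: fin_num_fun_lty.
rewrite integralD//; last exact: integrableZl.
rewrite integralZl// integral_indic// setIT.
rewrite [X in _ * X + _](_ : _ = (expR (- t * enorm xi ^+ 2))%:E); last first.
  exact: waiting_time_law.
rewrite -EFinM.
rewrite (integral_branched d_gt0 h_kernel cascade mchi0 Q_sub Q_full Q_neq0 X_finite)//.
rewrite fineD//; last first.
  apply: integrable_fin_num => //.
  exact: (integrable_mean_odot d_gt0 h_kernel cascade mchi0 Q_sub Q_full Q_neq0 X_finite).
by rewrite /= mulrC.
Qed.

Let measurable_mean_comp (g : R * E -> E) : measurable_fun setT g ->
  cvmeasurable (fun p : R * E => mean (g p) p.1).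
Proof.
move=> mg; apply: (cvmeasurable_comp (measurable_law_mean d_gt0 h_kernel cascade mchi0)
  (g := fun p : R * E => (g p, p.1))).
exact: measurable_fun_pair.
Qed.

Lemma ae_eq_integral_offspring xi s (F : V -> R -> R) : xi != 0%R ->
  \int[lebesgue_rV d]_eta (F (odot xi (chi eta s) (chi (xi - eta)%R s))
     (branching_density h eta xi))%:E =
  \int[lebesgue_rV d]_eta (F (odot xi (mean eta s) (mean (xi - eta)%R s))
     (offspring_density h xi eta))%:E.
Proof.
move=> xi0; apply: (integral_eq_off_null (N := [set 0%R] `|` [set xi])).
- by apply: measurableU; exact: measurable_rowvec1.
- exact: null_set_setU (measurable_rowvec1 _) (measurable_rowvec1 _)
    (lebesgue_rV1 _ d_gt0) (lebesgue_rV1 _ d_gt0).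
move=> eta /= /not_orP[/eqP eta0 /eqP etaxi].
have xieta0 : (xi - eta != 0)%R by rewrite subr_eq0 eq_sym.
have chiE := solution_meanE cascade mchi0 s.
by rewrite (chiE _ eta0) (chiE _ xieta0) (offspring_densityE h xi0 eta0 etaxi).
Qed.

(** Fubini's theorem in the waiting time and the first child. The inner integral
    makes sense for almost every waiting time only, which does not affect the
    outer one. *)
Lemma integral_mean_odot xi t k : Q (xi, t) ->
  \int[lts]_y (rcoord k (mean_odot xi t y) * dens xi y)%:E =
  \int[@lebesgue_measure R]_(s in `[0%R, t]) (rcoord k
    ((expR (- s * enorm xi ^+ 2) * enorm xi ^+ 2)%:C%C *:
       cvintegral (lebesgue_rV d) setT (fun eta =>
          (branching_density h eta xi)%:C%C *:
            odot xi (chi eta (t - s)%R) (chi (xi - eta)%R (t - s)%R))))%:E.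
Proof.
move=> Qxt; have xi0 := Q_neq0 Qxt.
have a0 : (0 < enorm xi ^+ 2)%R by rewrite exprn_gt0 ?enorm_gt0.
have int := integrable_mean_odot d_gt0 h_kernel cascade mchi0 Q_sub Q_full Q_neq0
  X_finite k Qxt.
rewrite -(integral12_prod_meas1 (m1 := lebesgue_measure) (m2 := lebesgue_rV d) int).
rewrite /fubini_F [RHS]integral_mkcond; apply: ae_eq_integralT.
apply: filterS (ae_integrable1 (m1 := lebesgue_measure) (m2 := lebesgue_rV d) int) => s ints.
rewrite patchE mem_setE in_itv/=.
have [st|st] := ifPn; last first.
  apply: integral0_eq => eta _; rewrite /mean_odot/= (negPf st).
  by rewrite /rcoord; case: ifP => _; rewrite mxE mul0r.
have [s0 _] := andP st.
have [_ rZ] := real_linear_rcoord (R := R) k.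
rewrite rZ rcoord_cvintegral.
under [X in fine X]eq_integral do rewrite rZ.
rewrite (ae_eq_integral_offspring (t - s) (fun a r => r * rcoord k a)%R xi0).
pose Z eta := (offspring_density h xi eta *
  rcoord k (odot xi (mean eta (t - s)%R) (mean (xi - eta)%R (t - s)%R)))%R.
pose c := (expR (- s * enorm xi ^+ 2) * enorm xi ^+ 2)%R.
have c0 : (0 < c)%R by rewrite mulr_gt0 ?expR_gt0.
have cZ eta : (rcoord k (mean_odot xi t (s, eta)) * dens xi (s, eta))%:E = c%:E * (Z eta)%:E.
  rewrite -EFinM /mean_odot/= st /split_density/= exponential_pdfE//; congr EFin.
  rewrite /c; have -> : (- s * enorm xi ^+ 2 = - enorm xi ^+ 2 * s)%R by ring.
  by rewrite /Z; ring.
have iZ : (lebesgue_rV d).-integrable setT (fun eta => (Z eta)%:E).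
  apply: (eq_integrable measurableT (fun eta => (c^-1)%:E *
    (rcoord k (mean_odot xi t (s, eta)) * dens xi (s, eta))%:E)) => [eta _|].
    by rewrite cZ muleA -(EFinM c^-1 c) mulVf ?gt_eqF// mul1e.
  exact: integrableZl.
under eq_integral do rewrite cZ.
rewrite integralZl// -/c (EFinM c) fineK//.
exact: (integrable_fin_num measurableT iZ).
Qed.

(** The expectation controls the bilinear term at the remaining time [t - s],
    with weight [exp (- s |xi|^2)], whereas here it is taken at time [s]. A
    reflection of [[0, t]] exchanges the two, and on this bounded interval the
    weights [exp (- s |xi|^2)] and [exp (- (t - s) |xi|^2)] are comparable. *)
Lemma integral_cnorm_odot_lty xi t : Q (xi, t) ->
  \int[@lebesgue_measure R]_(s in `[0%R, t])
     ((enorm xi ^+ 2 * expR (- enorm xi ^+ 2 * s))%:E *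
      \int[lebesgue_rV d]_eta
        (cnorm (odot xi (chi eta s) (chi (xi - eta)%R s)) *
           branching_density h eta xi)%:E) < +oo.
Proof.
move=> Qxt; have xi0 := Q_neq0 Qxt; have [/= t0 _] := Q_sub Qxt.
set a := (enorm xi ^+ 2)%R.
have a0 : (0 < a)%R by rewrite exprn_gt0 ?enorm_gt0.
pose G (s : R) eta := (cnorm (odot xi (mean eta s) (mean (xi - eta)%R s)) *
  offspring_density h xi eta)%R.
have G0 s eta : (0 <= G s eta)%R by rewrite mulr_ge0 ?cnorm_ge0 ?offspring_density_ge0.
have mG : measurable_fun setT (fun p : measurableTypeR R * E => (G p.1 p.2)%:E).
  apply/measurable_EFinP; apply: measurable_funM; last first.
    by apply: (measurable_offspring_density h_kernel) => //; exact: measurable_cst.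
  apply: cvmeasurable_cnorm; apply: cvmeasurable_odot; first exact: measurable_cst.
    exact: (measurable_mean_comp (@measurable_snd _ _ R E)).
  by apply: measurable_mean_comp; apply: measurable_rowvecB => //; exact: measurable_snd.
pose N s := \int[lebesgue_rV d]_eta (G s eta)%:E.
have mN : measurable_fun setT (N : measurableTypeR R -> \bar R).
  apply: (@measurable_fun_fubini_tonelli_F _ _ _ _ _ (lebesgue_rV d)
    (fun p : measurableTypeR R * E => (G p.1 p.2)%:E)) => //.
  by move=> p; rewrite lee_fin.
have N0 s : 0 <= N s by apply: integral_ge0 => eta _; rewrite lee_fin.
under eq_integral do rewrite (ae_eq_integral_offspring _ (fun v r => cnorm v * r)%R xi0) -/(N _).
(* After the reflection s |-> t - s, B carries the weight exp (- a s); the factor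
   exp (a t) bounds the ratio of the two weights on [0, t]. *)
pose B (s : measurableTypeR R) : \bar R :=
  (a * expR (- a * (t - s)))%:E * (N \_ `[0%R, t]) s.
have mI : measurable (`[0%R, t]%classic : set (measurableTypeR R)) by [].
have mB : measurable_fun setT B.
  apply: emeasurable_funM.
    apply/measurable_EFinP; apply: measurable_funM => //.
    apply: measurableT_comp => //; apply: measurable_funM => //.
    exact: measurable_funB.
  by apply/(measurable_restrictT _ mI); exact: measurable_funTS.
have NB0 s : 0 <= (N \_ `[0%R, t]) s by rewrite patchE; case: ifP.
have B0 s : 0 <= B s by rewrite mule_ge0// lee_fin mulr_ge0 ?expR_ge0 ?ltW.
apply: (@le_lt_trans _ _ (\int[@lebesgue_measure R]_s ((expR (a * t))%:E * B s))).
  rewrite integral_mkcond; apply: ge0_le_integral => //.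
  - by move=> s _; rewrite patchE; case: ifP => // _;
      rewrite mule_ge0// lee_fin mulr_ge0 ?expR_ge0 ?ltW.
  - apply/(measurable_restrictT _ mI); apply: measurable_funTS.
    apply: emeasurable_funM => //; apply/measurable_EFinP; apply: measurable_funM => //.
    by apply: measurableT_comp => //; apply: measurable_funM.
  - exact: measurable_funeM.
  - move=> s _; rewrite patchE mem_setE in_itv/=; case: ifPn => [/andP[s0 st]|_]; last first.
      by rewrite mule_ge0// lee_fin expR_ge0.
    rewrite /B patchE mem_setE in_itv/= s0 st/= muleA -EFinM.
    apply: lee_wpmul2r => //; rewrite lee_fin mulrCA ler_wpM2l ?(ltW a0)//.
    by rewrite -expRD ler_expR; nra.
rewrite ge0_integralZl// ?lee_fin ?expR_ge0// lte_mul_pinfty ?lee_fin ?expR_ge0//.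
have mrefl : measurable_fun setT (fun s : measurableTypeR R => (t - s)%R : measurableTypeR R).
  exact: measurable_funB.
rewrite (integral_pushforwardT (mu := @lebesgue_measure R) mrefl mB); last first.
  by move=> A mA; rewrite [RHS]lebesgue_reflect.
have := integral_cnorm_mean_odot d_gt0 h_kernel cascade mchi0 Q_sub Q_full Q_neq0
  X_finite Qxt.
rewrite (fubini_tonelli1 (m1 := lebesgue_measure) (m2 := lebesgue_rV d))//; first last.
- by move=> y; rewrite lee_fin mulr_ge0 ?cnorm_ge0//; exact: (split_density_ge0 h_kernel).
- apply/measurable_EFinP; apply: measurable_funM.
    by apply: cvmeasurable_cnorm; exact: (measurable_mean_odot d_gt0 h_kernel cascade).
  exact: (measurable_split_density1 h_kernel).
congr (_ < _); apply: eq_integral => s _; rewrite /fubini_F /B patchE mem_setE in_itv/=.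
rewrite subr_ge0 gerBl andbC /mean_odot/=.
have [st|st] := ifPn; last first.
  by rewrite mule0 integral0_eq// => eta _; rewrite cnorm0 mul0r.
have [s0 _] := andP st.
rewrite subKr -ge0_integralZl//.
- apply: eq_integral => eta _; rewrite /split_density/= exponential_pdfE// -EFinM.
  by congr EFin; rewrite /G -/a; ring.
- exact: (measurable_fun_pair2 _ mG).
- by move=> eta _; rewrite lee_fin.
- by rewrite lee_fin mulr_ge0 ?expR_ge0 ?ltW.
Qed.

End final.

(** * Existence of mild solutions through the cascade *)

Theorem proposition2p2 (R : realType) (d : nat) (d_ge3 : (3 <= d)%N)
  (h : 'rV[R]_d -> R) (h_kernel : standard_majorizing_kernel h)
  (dO : measure_display) (Omega : measurableType dO)
  (P : 'rV[R]_d -> probability Omega R)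
  (W : 'rV[R]_d -> vertex -> Omega -> 'rV[R]_d)
  (tau : 'rV[R]_d -> vertex -> Omega -> R)
  (cascade : is_cascade h P W tau)
  (chi0 : 'rV[R]_d -> 'rV[R[i]]_d) (chi0_meas : cvmeasurable_on setT chi0)
  (T : \bar R) (T_gt0 : (0 < T)%E)
  (Q : set ('rV[R]_d * R))
  (Q_sub : Q `<=` [set q | 0 <= q.2 /\ (q.2%:E < T)%E])
  (Q_full : (lebesgue_rV d \x lebesgue_measure)%E.-negligible
     ([set q | 0 <= q.2 /\ (q.2%:E < T)%E] `\` Q))
  (Q_neq0 : forall xi t, Q (xi, t) -> xi != 0)
  (X_finite : forall xi t, Q (xi, t) ->
     (\int[P xi]_omega (cnorm (solution_process W tau chi0 xi t omega))%:E
        < +oo)%E) :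
  let H := branching_density h in
  let X := solution_process W tau chi0 in
  let chi := solution_mean P W tau chi0 in
  [/\ forall xi t, Q (xi, t) -> cvintegrable (P xi) setT (X xi t),
      cvmeasurable_on Q (fun q => chi q.1 q.2),
      forall xi t, Q (xi, t) ->
        (\int[lebesgue_measure]_(s in `[0%R, t])
           ((enorm xi ^+ 2 * expR (- enorm xi ^+ 2 * s))%:E *
            \int[lebesgue_rV d]_eta
              (cnorm (odot xi (chi eta s) (chi (xi - eta) s)) * H eta xi)%:E)
         < +oo)%E
    & forall xi t, Q (xi, t) ->
        chi xi t =
          (expR (- t * enorm xi ^+ 2))%:C *: chi0 xi +
          cvintegral lebesgue_measure `[0, t] (fun s =>
            (expR (- s * enorm xi ^+ 2) * enorm xi ^+ 2)%:C *:
            cvintegral (lebesgue_rV d) setT (fun eta =>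
              (H eta xi)%:C *:
              odot xi (chi eta (t - s)) (chi (xi - eta) (t - s))))].
Proof.
move=> H X chi; rewrite {}/H {}/X {}/chi.
have d_gt0 : (0 < d)%N by exact: leq_trans d_ge3.
have mchi0 := cvmeasurable_onP chi0_meas.
split => [xi t Qxt|j|xi t Qxt|xi t Qxt].
- exact: (integrable_process cascade mchi0 Q_neq0 X_finite).
- have mm k : measurable_on Q
      (fun q => rcoord k (solution_mean P W tau chi0 q.1 q.2)).
    move=> Y mY.
    have := measurable_law_mean d_gt0 h_kernel cascade mchi0 k measurableT mY.
    rewrite setTI => mA; exists ((fun q : 'rV[R]_d * R => rcoord k
      (law_mean cascade chi0 q.1 q.2)) @^-1` Y) => //.
    apply/seteqP; split => -[xi t] /= [Yq Qq]; split => //; move: Yq;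
      by rewrite (solution_meanE cascade)//; exact: Q_neq0 Qq.
  by split; [exact: (mm (j, false))|exact: (mm (j, true))].
- exact: (integral_cnorm_odot_lty d_gt0 h_kernel cascade mchi0 Q_sub Q_full
    Q_neq0 X_finite).
- apply: rcoord_eq => k; have [rD rZ] := real_linear_rcoord (R := R) k.
  rewrite rD rZ rcoord_cvintegral.
  rewrite (solution_mean_split d_gt0 h_kernel cascade mchi0 Q_sub Q_full Q_neq0
    X_finite)//.
  by rewrite (integral_mean_odot d_gt0 h_kernel cascade mchi0 Q_sub Q_full Q_neq0
    X_finite).
Qed.
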